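(* Let $d\ge 1$ be an integer, $R>0$ and $p\in(0,1]$, and let $(\mathrm{RGG}_n(p,R))_{n\ge 1}$ be the sequence of $d$-dimensional random geometric graphs with connection radius $R$ and connection probability $p$. Then $$r(\mathrm{RGG}_n(p,R))\ \xrightarrow{\ \mathbb{P}\ }\ p\,p_{\mathrm{conn}}\qquad (n\to\infty),$$ where $r(\cdot)$ is Pearson's degree-degree correlation coefficient and $$p_{\mathrm{conn}}=\frac{1}{\omega_d(R)^2}\iint_{x,y\in B(0,R)}\mathbf{1}_{\{\|x-y\|\le R\}}\,dx\,dy.$$
   Context: Random geometric graph: let $\mathbb{T}_n^d$ be the $d$-dimensional torus of volume $n$, i.e. the box $[-n^{1/d}/2,n^{1/d}/2]^d$ with opposite boundaries identified, with torus metric $\|\cdot\|_n$. $\mathrm{RGG}_n(p,R)$ has $n$ vertices placed at independent uniform points $X_1,\dots,X_n$ of the torus, and, given the positions, each pair $i\ne j$ is connected independently with probability $p\,\mathbf{1}_{\{\|X_i-X_j\|_n\le R\}}$. $B(0,R)$ is the Euclidean ball of radius $R$ around $0$ in $\mathbb{R}^d$, $\|\cdot\|$ is the Euclidean norm, and $\omega_d(R)=\frac{\pi^{d/2}}{\Gamma(1+d/2)}R^d$ is the volume of $B(0,R)$. For a finite graph $G$ with vertex degrees $d_v$, $\vec{E}(G)$ is the set of ordered pairs $(u,v)$ with $\{u,v\}\in E(G)$, $\sum_{u\to v}$ is summation over $\vec{E}(G)$, and Pearson's correlation coefficient is $$r(G)=\frac{\sum_{u\to v}d_ud_v-\frac{1}{|\vec{E}(G)|}\left(\sum_{v\in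 V(G)}d_v^2\right)^2}{\sum_{v\in V(G)}d_v^3-\frac{1}{|\vec{E}(G)|}\left(\sum_{v\in V(G)}d_v^2\right)^2},$$ with an arbitrary value assigned when this expression is undefined (no edges or zero denominator). *)

(* Defs.v *)
From HB Require Import structures.
From mathcomp Require Import all_boot all_order all_algebra.
From mathcomp Require Import all_classical all_reals all_analysis.

Set Implicit Arguments.
Unset Strict Implicit.
Unset Printing Implicit Defensive.

Import Order.TTheory GRing.Theory Num.Theory.
Import numFieldNormedType.Exports.

Local Open Scope classical_set_scope.
Local Open Scope ring_scope.

(* Points of R^d are d-tuples, whose sigma-algebra is the one generated by the
   coordinates. Lebesgue measure on R^d is obtained by recursion on d as the
   product of one-dimensional Lebesgue measures, starting from the point mass
   on R^0; lebesgue_box states that it gives boxes their usual volume. *)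

Definition cons_pair (R : realType) (d : nat) (z : R * d.-tuple R) :
  d.+1.-tuple R := [tuple of z.1 :: z.2].

Lemma measurable_cons_pair (R : realType) (d : nat) :
  measurable_fun [set: R * d.-tuple R] (@cons_pair R d).
Proof. by apply: (@measurable_cons _ _ _ _ fst d snd). Qed.

Lemma product_sigma_finite d1 d2 (T1 : measurableType d1)
    (T2 : measurableType d2) (R : realType)
    (m1 : {sigma_finite_measure set T1 -> \bar R})
    (m2 : {sigma_finite_measure set T2 -> \bar R}) :
  sigma_finite setT (m1 \x m2)%E.
Proof.
have /sigma_finiteP[F [TF ndF Foo]] := sigma_finiteT m1.
have /sigma_finiteP[G [TG ndG Goo]] := sigma_finiteT m2.
exists (fun n => F n `*` G n).
  rewrite -setXTT TF TG predeqE => -[x y]; split.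
    move=> [/= [n _ Fnx] [k _ Gky]]; exists (maxn n k) => //; split.
    - by move: x Fnx; exact/subsetPset/ndF/leq_maxl.
    - by move: y Gky; exact/subsetPset/ndG/leq_maxr.
  by move=> [n _ []/= ? ?]; split; exists n.
move=> k; have [? ?] := Foo k; have [? ?] := Goo k.
split; first exact: measurableX.
by rewrite product_measure1E// lte_mul_pinfty// ge0_fin_numE.
Qed.

Section lebesgue_step.
Context (R : realType) (d : nat).
Variable mu : {sigma_finite_measure set (d.-tuple R) -> \bar R}.
Local Open Scope ereal_scope.

Definition lebesgue_step : set (d.+1.-tuple R) -> \bar R :=
  pushforward (@lebesgue_measure R \x mu) (@cons_pair R d).

Let lebesgue_step0 : lebesgue_step set0 = 0.
Proof. by rewrite /lebesgue_step /pushforward preimage_set0 measure0. Qed.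

Let lebesgue_step_ge0 A : 0 <= lebesgue_step A.
Proof. exact: (@measure_ge0 _ _ _ (@lebesgue_measure R \x mu)). Qed.

Let lebesgue_step_sigma_additive : semi_sigma_additive lebesgue_step.
Proof.
exact: (@measure_semi_sigma_additive _ _ _
  (measure_function_pushforward__canonical__measure_function_Measure
     (@lebesgue_measure R \x mu) (@measurable_cons_pair R d))).
Qed.

HB.instance Definition _ := isMeasure.Build _ _ _ lebesgue_step
  lebesgue_step0 lebesgue_step_ge0 lebesgue_step_sigma_additive.

Let lebesgue_step_sigma_finite : sigma_finite setT lebesgue_step.
Proof.
have [F FT mF] := product_sigma_finite (@lebesgue_measure R) mu.
pose uncons (x : d.+1.-tuple R) : R * d.-tuple R :=
  (thead x, [tuple of behead x]).
have unconsK : cancel uncons (@cons_pair R d).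
  by move=> x; rewrite /cons_pair /uncons /= [RHS]tuple_eta; exact: val_inj.
have cons_pairK : cancel (@cons_pair R d) uncons.
  by move=> [a x]; rewrite /uncons /cons_pair /= theadE; congr pair; exact: val_inj.
have muncons : measurable_fun setT uncons.
  apply/measurable_fun_pairP; split; last exact: measurable_behead.
  exact: measurable_tnth.
exists (fun k => uncons @^-1` F k).
  by rewrite -preimage_bigcup -FT preimage_setT.
move=> k; have [mFk Fkoo] := mF k; split.
  by rewrite -[X in measurable X]setTI; exact: muncons.
rewrite /lebesgue_step /pushforward.
rewrite (_ : _ @^-1` _ = F k)//.
by apply/seteqP; split=> z /=; rewrite cons_pairK.
Qed.

HB.instance Definition _ := @Measure_isSigmaFinite.Build _ _ _ lebesgue_step
  lebesgue_step_sigma_finite.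

End lebesgue_step.

Fixpoint lebesgue (R : realType) (d : nat) :
    {sigma_finite_measure set (d.-tuple R) -> \bar R} :=
  if d is d'.+1 then lebesgue_step (lebesgue R d') else \d_ [tuple].

Lemma lebesgue_box (R : realType) (d : nat) (A : 'I_d -> set R) :
  (forall i, measurable (A i)) ->
  lebesgue R d [set x | forall i, A i (tnth x i)] =
  (\prod_(i < d) lebesgue_measure (A i))%E.
Proof.
elim: d A => [|d IH] A mA.
  by rewrite big_ord0 /= diracE mem_set//= => -[].
have mbox : measurable [set x : d.-tuple R | forall i, A (lift ord0 i) (tnth x i)].
  rewrite (_ : mkset _ =
      \big[setI/setT]_(i < d) ((@tnth d R)^~ i @^-1` A (lift ord0 i))).
    apply: bigsetI_measurable => i _.
    by rewrite -[X in measurable X]setTI; exact: measurable_tnth.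
  apply/seteqP; split=> x /=.
    by move=> Ax; rewrite -bigcap_seq => i _ /=; exact: Ax.
  by rewrite -bigcap_seq => Ax i; apply: Ax; rewrite /= mem_index_enum.
rewrite big_ord_recl -IH//.
rewrite -(@product_measure1E _ _ _ _ _ (@lebesgue_measure R) (lebesgue R d)) //; last exact: mA.
have cons0 a x : tnth (@cons_pair R d (a, x)) ord0 = a by [].
have consS a x i : tnth (@cons_pair R d (a, x)) (lift ord0 i) = tnth x i.
  by rewrite /cons_pair tnthS.
rewrite /= /lebesgue_step /pushforward; congr (_ _).
apply/seteqP; split=> -[a x] /= => [Ax|[Aa Ax] i].
  split=> [|i]; first by have := Ax ord0; rewrite cons0.
  by have := Ax (lift ord0 i); rewrite consS.
by case: (unliftP ord0 i) => [j|] ->; rewrite ?consS ?cons0.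
Qed.

Section euclidean.
Context (R : realType) (d : nat).
Implicit Types x y : d.-tuple R.

Definition tsub x y : d.-tuple R := [tuple tnth x i - tnth y i | i < d].

Definition enorm x : R := Num.sqrt (\sum_(i < d) tnth x i ^+ 2).

Definition eball (rad : R) : set (d.-tuple R) := [set x | enorm x <= rad].

End euclidean.
Arguments eball {R} d rad.

Definition Gamma (R : realType) (z : R) : R :=
  \int[lebesgue_measure]_(t in `]0, +oo[) (t `^ (z - 1) * expR (- t)).

Definition omega (R : realType) (d : nat) (rad : R) : R :=
  pi `^ (d%:R / 2) / Gamma (1 + d%:R / 2) * rad ^+ d.

Definition p_conn (R : realType) (d : nat) (rad : R) : R :=
  (omega d rad ^+ 2)^-1 *
  \int[lebesgue R d]_(x in eball d rad)
    \int[lebesgue R d]_(y in eball d rad) ((enorm (tsub x y) <= rad)%R%:R : R).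

(* The torus T_n^d: its points are represented in the box of side n^(1/d), and
   the distance of two points is the infimum of the Euclidean distances of
   their representatives modulo the lattice n^(1/d) Z^d. *)
Section torus.
Context (R : realType) (d n : nat).

Definition side : R := n%:R `^ d%:R^-1.

Definition torus_box : set (d.-tuple R) :=
  [set x | forall i, `|tnth x i| <= side / 2].

Definition torus_dist (x y : d.-tuple R) : R :=
  inf (range (fun k : 'I_d -> int =>
    enorm [tuple tnth x i - tnth y i + (k i)%:~R * side | i < d])).

End torus.
Arguments torus_box {R} d n.

Record sgraph (V : finType) := SGraph {
  adj : rel V ;
  adj_sym : symmetric adj ;
  adj_irrefl : irreflexive adj }.

Section pearson.
Context (R : realType) (V : finType).
Variables (c : R) (G : sgraph V).

Definition deg (v : V) : nat := #|adj G v|.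

Definition arcs : {set V * V} := [set e | adj G e.1 e.2]%SET.

Let correction : R := #|arcs|%:R^-1 * (\sum_(v : V) (deg v)%:R ^+ 2) ^+ 2.
Let numerator : R :=
  \sum_(e in arcs) (deg e.1)%:R * (deg e.2)%:R - correction.
Let denominator : R := \sum_(v : V) (deg v)%:R ^+ 3 - correction.

(* c is the arbitrary value taken when the quotient is undefined. *)
Definition pearson : R :=
  if (#|arcs| == 0)%N || (denominator == 0) then c
  else numerator / denominator.

End pearson.

Section rgg.
Context (R : realType) (d n : nat) (p rad : R).
Context (disp : measure_display) (T : measurableType disp).
Variable P : probability T R.
Variables (X : 'I_n -> {RV P >-> d.-tuple R}) (G : T -> sgraph 'I_n).

Definition positions (w : T) : n.-tuple (d.-tuple R) := [tuple X i w | i < n].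

Definition connect_prob (w : T) (i j : 'I_n) : R :=
  p * (torus_dist n (X i w) (X j w) <= rad)%R%:R.

(* G is RGG_n(p, rad) with vertex positions X. The last field says that,
   conditionally on the sigma-algebra generated by X, the pairs i < j are
   edges independently of each other, with probabilities connect_prob. *)
Record is_RGG : Prop := {
  rgg_uniform : forall (i : 'I_n) (A : set (d.-tuple R)), measurable A ->
    distribution P (X i) A =
    ((n%:R^-1)%:E * lebesgue R d (A `&` torus_box d n))%E ;
  rgg_independent : forall A : 'I_n -> set (d.-tuple R),
    (forall i, measurable (A i)) ->
    P [set w | forall i, A i (X i w)] = (\prod_(i < n) P (X i @^-1` A i))%E ;
  rgg_measurable : forall i j : 'I_n, measurable [set w | adj (G w) i j] ;
  rgg_edges : forall (B : set (n.-tuple (d.-tuple R))) (g : sgraph 'I_n),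
    measurable B ->
    P (positions @^-1` B `&` [set w | adj (G w) =2 adj g]) =
    (\int[P]_(w in positions @^-1` B)
      (\prod_(i < n) \prod_(j < n | (i < j)%N)
        (if adj g i j then connect_prob w i j
         else 1 - connect_prob w i j))%R%:E)%E }.

End rgg.

(* Convergence in probability to a constant; the variables may live on
   different probability spaces. *)
Definition cvg_in_probability (R : realType) (disp : nat -> measure_display)
    (T : forall n, measurableType (disp n)) (P : forall n, probability (T n) R)
    (Y : forall n, T n -> R) (l : R) : Prop :=
  forall eps : R, 0 < eps ->
    P n [set w | eps < `|Y n w - l|] @[n --> \oo] --> 0%E.

(* Main.v *)
(* The sums in the coefficient are combinations of subgraph counts. With N_H
   the number of labelled copies of H in the graph,
     #arcs = N_edge,  sum d^2 = N_cherry + N_edge,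
     sum d^3 = N_claw + 3 N_cherry + N_edge,
     sum_(u -> v) d_u d_v = N_path + N_triangle + 2 N_cherry + N_edge,
   where the path has three edges. Attaching a leaf to a pattern multiplies its
   probability by exactly mu / n with mu = p omega, because a ball of radius R
   embeds into the torus once n^(1/d) > 3 R; hence E N_H / n tends to mu^k for a
   tree with k edges, and to p^3 omega^2 p_conn for the triangle. Copies on
   disjoint vertex sets are independent, and the pairs of copies of H that meet
   are bounded by a power of the number of short walks from a common vertex, of
   which the expectation is O(1), again by attaching leaves. So Var N_H = O(n)
   and N_H / n converges in probability by Chebyshev's inequality. After
   cancellation the coefficient has the limit (p^3 omega^2 p_conn) / mu^2.
   That omega, defined through Gamma, is the volume of the ball follows from
   the Gaussian integral. *)
Require Import Defs.
From mathcomp Require Import all_boot all_order all_algebra.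
From mathcomp Require Import all_classical all_reals all_analysis.
From mathcomp Require Import measurable_realfun ring lra.
Import Order.TTheory GRing.Theory Num.Theory.
Import numFieldNormedType.Exports.
Local Open Scope classical_set_scope.
Local Open Scope ring_scope.
Set Implicit Arguments.
Unset Strict Implicit.
Unset Printing Implicit Defensive.

(** * Lebesgue measure on R^d *)

(** Exact probabilities are available only for forests and for the triangle, whereas two overlapping
    copies of a pattern may close up cycles of any shape. Second moments are therefore only bounded
    from above, by exposing walks one step at a time. A step leads either to one of the at most k
    vertices already exposed, where its probability is bounded by 1, or to a new vertex, where its
    edge is a leaf of probability q. This gives a factor k + n q per step, and n q = mu does not
    depend on n. The choice of the common vertex costs the single factor n in the variance. The
    probabilistic input is condensed in [edge_law]. Everything about counts then happens on the
    finite set of arc sets, where expectations are finite sums. The constant 3 in 3 R < n^(1/d)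
    comes from the triangle: three points that are pairwise near on the torus have pairwise near
    lifts in R^d, since going once around them shifts each coordinate by at most 3 R, less than one
    period. *)

Definition box (T : Type) (n : nat) (A : 'I_n -> set T) : set (n.-tuple T) :=
  [set x | forall i, A i (tnth x i)].

Section boxes.
Context (dT : measure_display) (T : measurableType dT) (n : nat).

Definition boxes : set (set (n.-tuple T)) :=
  [set B | exists2 A, (forall i, measurable (A i)) & B = box A].

Lemma measurable_box (A : 'I_n -> set T) :
  (forall i, measurable (A i)) -> measurable (box A).
Proof.
move=> mA; rewrite (_ : box A =
    \big[setI/setT]_(i < n) ((@tnth n T)^~ i @^-1` A i)).
  apply: bigsetI_measurable => i _.
  by rewrite -[X in measurable X]setTI; exact: measurable_tnth.
apply/seteqP; split=> x /=.
  by move=> Ax; rewrite -bigcap_seq => i _ /=; exact: Ax.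
by rewrite -bigcap_seq => Ax i; apply: Ax; rewrite /= mem_index_enum.
Qed.

Lemma setI_closed_boxes : setI_closed boxes.
Proof.
move=> _ _ [A mA ->] [B mB ->]; exists (fun i => A i `&` B i).
  by move=> i; exact: measurableI.
apply/seteqP; split=> x /=; first by move=> [Ax Bx] i; split; [exact: Ax|exact: Bx].
by move=> ABx; split=> i; have [] := ABx i.
Qed.

Lemma boxesT : boxes setT.
Proof. by exists (fun=> setT) => //; apply/seteqP; split=> x. Qed.

(** Boxes replace the coordinate cylinders as generators because they are stable under intersection,
    as uniqueness of measures requires. *)
Lemma measurable_boxesE : @measurable _ (n.-tuple T) = <<s boxes >>.
Proof.
apply/seteqP; split; last first.
  apply: smallest_sub; first exact: sigma_algebra_measurable.
  by move=> _ [A mA ->]; exact: measurable_box.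
apply: smallest_sub; first exact: smallest_sigma_algebra.
rewrite -bigcup_seq => B [i /= _ [A mA <-]]; apply: sub_sigma_algebra.
exists (fun j => if j == i then A else setT); first by move=> j; case: ifP.
apply/seteqP; split=> x /=.
  by move=> [_ Ax] j; case: eqP => [->//|].
by move=> /(_ i); rewrite eqxx.
Qed.

End boxes.

Section affine.
Context (R : realType).
Implicit Types (r t : R) (d : nat).

Lemma lebesgue_measure_affine r t (A : set R) : 0 < r -> measurable A ->
  (r%:E * lebesgue_measure [set x | A (r * x + t)%R] = lebesgue_measure A)%E.
Proof.
move=> r0 mA.
have mf : measurable_fun [set: measurableTypeR R] (fun x : measurableTypeR R => (r * x + t : measurableTypeR R)).
  by apply: measurable_funD => //; exact: mulrl_measurable.
pose m := mscale (NngNum (ltW r0))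
  (measure_function_pushforward__canonical__measure_function_Measure
     (@lebesgue_measure R) mf).
rewrite [RHS](@lebesgue_measure_unique R m)// => _ [[a b]] _ <-.
transitivity (r%:E *
    lebesgue_measure `](r^-1 * (a - t))%R, (r^-1 * (b - t))%R]%classic)%E; last first.
  congr (_ * lebesgue_measure _)%E; apply/seteqP; split=> x /=;
    rewrite !in_itv /= !(mulrC r^-1) ltr_pdivrMr// ler_pdivlMr//;
    by rewrite ltrBlDr lerBrDr (mulrC x).
rewrite !lebesgue_measure_itv /= !lte_fin ltr_pM2l ?invr_gt0// ltrD2r.
case: ifPn => ab; last by rewrite mule0.
by rewrite -!EFinD -EFinM; congr EFin; field; rewrite gt_eqF.
Qed.

(** Reduces scaling and translation in R^d to the one-dimensional case, side by side. *)
Lemma lebesgue_unique d (m : {measure set (d.-tuple R) -> \bar R}) :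
  (forall A : 'I_d -> set R, (forall i, measurable (A i)) ->
    m (box A) = (\prod_(i < d) lebesgue_measure (A i))%E) ->
  forall A, measurable A -> m A = lebesgue R d A.
Proof.
move=> mbox A.
rewrite measurable_boxesE => sA.
pose J k : set R := `[- k%:R, k%:R]%classic.
pose g k : set (d.-tuple R) := box (fun=> J k).
apply: (@g_sigma_algebra_measure_unique _ _ _ (@boxes _ R d) _ g) => //.
- by move=> _ [B mB ->]; exact: measurable_box.
- by move=> k; exists (fun=> J k) => // i; exact: measurable_itv.
- rewrite -subTset => x _.
  (* The sum of all moduli bounds every coordinate, so one index serves for all of them. *)
  exists (Num.truncn (\sum_(i < d) `|tnth x i|)).+1; first by [].
  move=> i; rewrite /J /= in_itv /= -ler_norml; apply: le_trans (ltW (truncnS_gt _)).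
  by rewrite (bigD1 i)//= lerDl sumr_ge0.
- exact: setI_closed_boxes.
- by move=> _ [B mB ->]; rewrite mbox// -lebesgue_box.
- move=> k; rewrite mbox//.
  have -> : (\prod_(i < d) lebesgue_measure (J k) =
      \prod_(i < d) (k%:R + k%:R : R)%R%:E)%E.
    apply: eq_bigr => i _; rewrite lebesgue_measure_itv /= lte_fin -EFinB opprK.
    (* For k = 0 the interval is a point, whose length is still k + k. *)
    case: ltP => // kk; congr EFin.
    by have := ler0n R k; lra.
  by rewrite prodEFin ltry.
  by move=> _; exact: measurable_itv.
Qed.

Definition taff d r (t x : d.-tuple R) : d.-tuple R :=
  [tuple r * tnth x i + tnth t i | i < d].

Lemma measurable_taff d r (t : d.-tuple R) : measurable_fun setT (taff r t).
Proof.
apply/measurable_fun_tnthP => i.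
rewrite (_ : _ \o _ = fun x : d.-tuple R => r * tnth x i + tnth t i); last first.
  by apply/funext => x /=; rewrite tnth_mktuple.
apply: measurable_funD => //.
by apply: measurable_funM => //; exact: measurable_tnth.
Qed.

(** On a box the factor r^d splits into one factor r for each side. *)
Lemma lebesgue_taff d r (t : d.-tuple R) (A : set (d.-tuple R)) :
  0 < r -> measurable A ->
  ((r ^+ d)%:E * lebesgue R d (taff r t @^-1` A) = lebesgue R d A)%E.
Proof.
move=> r0 mA.
pose m := mscale (NngNum (exprn_ge0 d (ltW r0)))
  (measure_function_pushforward__canonical__measure_function_Measure
     (lebesgue R d) (measurable_taff r t)).
rewrite -[RHS](@lebesgue_unique d m)// => {mA}A {}mA.
transitivity ((r ^+ d)%:E * lebesgue R d (box (fun i =>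
    [set x | A i (r * x + tnth t i)%R])))%E.
  congr (_ * lebesgue R d _)%E; apply/seteqP; split=> x /= Ax i.
    by have := Ax i; rewrite tnth_mktuple.
  by rewrite tnth_mktuple; exact: Ax.
rewrite lebesgue_box; last first.
  move=> i; rewrite -[X in measurable X]setTI.
  have mf : measurable_fun [set: R] (fun x : R => r * x + tnth t i).
    by apply: measurable_funD => //; exact: mulrl_measurable.
  exact: mf.
rewrite -[d in (r ^+ d)%R](card_ord d) -prodr_const -prodEFin -big_split /=.
by apply: eq_bigr => i _; exact: lebesgue_measure_affine.
Qed.

Lemma ge0_integral_translate d (t : d.-tuple R) (h : d.-tuple R -> \bar R) :
  measurable_fun setT h -> (forall x, 0 <= h x)%E ->
  (\int[lebesgue R d]_x h (taff 1 t x) = \int[lebesgue R d]_x h x)%E.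
Proof.
move=> mh h0.
have := ge0_integral_pushforward (measurable_taff 1 t) (lebesgue R d)
  (@measurableT _ _) mh (fun x _ => h0 x).
rewrite preimage_setT => <-.
apply: eq_measure_integral => [|mt A mA _]; first exact: measurable_taff.
by have := lebesgue_taff t ltr01 mA; rewrite expr1n mul1e.
Qed.

End affine.

(** * The volume of a ball *)

Section ball_volume.
Context (R : realType).
Implicit Types (d : nat).

Definition sqnorm d (x : d.-tuple R) : R := \sum_(i < d) tnth x i ^+ 2.

Lemma sqnorm_ge0 d (x : d.-tuple R) : 0 <= sqnorm x.
Proof. by apply: sumr_ge0 => i _; exact: sqr_ge0. Qed.

Lemma measurable_sqnorm d : measurable_fun setT (@sqnorm d).
Proof.
by apply: measurable_sum => i; apply: measurable_funX; exact: measurable_tnth.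
Qed.

Lemma enorm_le d (x : d.-tuple R) (r : R) : 0 <= r ->
  (enorm x <= r) = (sqnorm x <= r ^+ 2).
Proof.
move=> r0; rewrite -(ler_sqr (sqrtr_ge0 _) r0) sqr_sqrtr//.
exact: sqnorm_ge0.
Qed.

Lemma measurable_eball d (r : R) : 0 <= r -> measurable (eball d r).
Proof.
move=> r0; rewrite (_ : eball d r = [set x | sqnorm x <= r ^+ 2]); last first.
  by apply/seteqP; split=> x; rewrite /eball /= enorm_le.
rewrite -[X in measurable X]setTI.
have := @measurable_sqnorm d measurableT _ (measurable_itv `]-oo, (r ^+ 2)]).
by rewrite set_itvE.
Qed.

Lemma lebesgue_eball d (r : R) : 0 < r ->
  (lebesgue R d (eball d r) = (r ^+ d)%:E * lebesgue R d (eball d 1))%E.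
Proof.
move=> r0.
rewrite -(lebesgue_taff [tuple 0 | i < d] r0 (measurable_eball (ltW r0))).
congr (_ * lebesgue R d _)%E.
suff -> : taff r [tuple 0 | i < d] @^-1` eball d r = eball d 1 by [].
have E x : (enorm (taff r [tuple 0 | i < d] x) <= r) = (enorm x <= 1).
  rewrite (enorm_le _ (ltW r0)) (enorm_le _ ler01) expr1n.
  rewrite (_ : sqnorm (taff _ _ _) = r ^+ 2 * sqnorm x) ?ger_pMr ?exprn_gt0//.
  rewrite mulr_sumr; apply: eq_bigr => i _.
  by rewrite !tnth_mktuple addr0 exprMn.
by apply/seteqP; split=> x; rewrite /eball /= E.
Qed.

Lemma integral_expRN_itvcy (s : R) :
  (\int[lebesgue_measure]_(t in `[s, +oo[) (expR (- t))%:E = (expR (- s))%:E)%E.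
Proof.
have dexp (x : R) : is_derive x 1 (fun t : R => - expR (- t)) (expR (- x)).
  by apply: is_derive_eq; rewrite mulrN1 opprK.
rewrite (@ge0_continuous_FTC2y _ _ (fun t => - expR (- t)) _ 0).
- by rewrite EFinN oppeK add0e.
- by move=> x _; exact: expR_ge0.
- apply: continuous_subspaceT => x.
  by apply: continuous_comp; [exact: opp_continuous|exact: continuous_expR].
- by rewrite -oppr0; apply: cvgN; exact: cvgr_expR.
- by move=> x _; apply: ex_derive.
- apply: cvg_at_right_filter; apply: cvgN.
  by apply: continuous_comp; [exact: opp_continuous|exact: continuous_expR].
- by move=> x _; rewrite derive1E; apply: derive_val.
Qed.

Lemma lebesgueS_integral d (f : d.+1.-tuple R -> \bar R) :
  measurable_fun setT f -> (forall x, 0 <= f x)%E ->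
  (\int[lebesgue R d.+1]_x f x =
   \int[lebesgue_measure]_a \int[lebesgue R d]_x f (cons_pair (a, x)))%E.
Proof.
move=> mf f0.
transitivity (\int[pushforward (@lebesgue_measure R \x lebesgue R d)
    (@cons_pair R d)]_x f x)%E; first by [].
rewrite ge0_integral_pushforward//; last first.
  exact: measurable_cons_pair.
rewrite preimage_setT.
rewrite fubini_tonelli1//; last by move=> x; exact: f0.
by apply: measurableT_comp => //; exact: measurable_cons_pair.
Qed.

Lemma integral_gauss d :
  (\int[lebesgue R d]_x (expR (- sqnorm x))%:E = (Num.sqrt pi ^+ d)%:E)%E.
Proof.
have mg k : measurable_fun setT (fun x : k.-tuple R => (expR (- sqnorm x))%:E).
  apply/measurable_EFinP; apply: measurableT_comp => //.
  by apply: measurableT_comp => //; exact: measurable_sqnorm.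
elim: d => [|d IH].
  rewrite integral_dirac//; last exact: mg.
  rewrite /dirac /= indicT mul1e /sqnorm big_ord0 oppr0.
  by rewrite expR0 expr0.
rewrite lebesgueS_integral//.
under eq_integral => a _.
  under eq_integral => x _.
    rewrite /sqnorm big_ord_recl /cons_pair tnth0 opprD expRD.
    under eq_bigr do rewrite tnthS.
    rewrite EFinM; over.
  rewrite /= ge0_integralZl//; last exact: mg.
  rewrite IH; over.
rewrite /= ge0_integralZr//; last first.
  apply/measurable_EFinP; exact: (@measurable_gauss_fun R).
by rewrite -/(gauss_fun _) integralT_gauss -EFinM exprS.
Qed.


(** The integral behind [Gamma (1 + d/2)], kept extended-real: [Gamma] only sees its [fine] part,
    which would hide divergence. Finiteness comes out of the Gaussian integral. *)
Definition gamma_integral d : \bar R :=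
  (\int[lebesgue_measure]_(t in `]0%R, +oo[)
    (t `^ (1 + d%:R / 2 - 1) * expR (- t))%:E)%E.

(* Layer cake: exp(-|x|^2) is the integral of exp(-t) over t >= |x|^2, so
   Tonelli turns the Gaussian integral into an integral of ball volumes. *)
Lemma gauss_ball_volume d :
  (lebesgue R d (eball d 1) * gamma_integral d = (Num.sqrt pi ^+ d)%:E)%E.
Proof.
rewrite -integral_gauss /gamma_integral.
apply/esym.
(* The condition 0 < t matches the open interval in [gamma_integral]. It changes the section over x
   only when |x| = 0, by the single point t = 0. *)
pose S : set (d.-tuple R * R) := [set z | sqnorm z.1 <= z.2 /\ 0 < z.2].
have mS : measurable S.
  rewrite -[X in measurable X]setTI.
  have ml := @measurable_fun_ler _ (d.-tuple R * R)%type R setT _ _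
    (measurableT_comp (@measurable_sqnorm d) measurable_fst) measurable_snd.
  have ml0 := @measurable_fun_ltr _ (d.-tuple R * R)%type R setT _ _
    (measurable_cst (0 : R)) measurable_snd.
  rewrite (_ : S = (fun z => (sqnorm z.1 <= z.2) && (0 < z.2)) @^-1` [set true]).
    by apply: (measurable_and ml ml0).
  by apply/seteqP; split=> x /= /andP.
pose f (z : d.-tuple R * R) : \bar R := (expR (- z.2) * \1_S z)%:E.
have f0 z : (0 <= f z)%E by rewrite lee_fin mulr_ge0 ?expR_ge0.
have mf : measurable_fun setT f.
  apply/measurable_EFinP; apply: measurable_funM; last exact: measurable_indic.
  by apply: measurableT_comp => //; exact: measurableT_comp.
have fub := fubini_tonelli (m1 := lebesgue R d) (m2 := @lebesgue_measure R) f mf f0.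
transitivity (\int[lebesgue R d]_x \int[lebesgue_measure]_y f (x, y))%E.
  apply: eq_integral => x _; rewrite -integral_expRN_itvcy.
  pose Sx : set R := [set t | sqnorm x <= t /\ 0 < t].
  transitivity (\int[lebesgue_measure]_(t in Sx) (expR (- t))%:E)%E; last first.
    rewrite [LHS]integral_mkcond; apply: eq_integral => t _.
    rewrite patchE /f indicE /=; case: ifPn => [/set_mem tx|tx].
      by rewrite mem_set// mulr1.
    by rewrite memNset ?mulr0//; move: tx; rewrite notin_setE.
  apply/esym.
  have [x0|] := ltP 0 (sqnorm x).
    congr (integral _ _ _); apply/seteqP; split=> t /=; rewrite in_itv /= andbT.
      by case.
    by move=> xt; split=> //; exact: lt_le_trans xt.
  rewrite le_eqVlt ltNge sqnorm_ge0 orbF => /eqP x0.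
  rewrite -integral_itv_obnd_cbnd; last first.
    apply/measurable_EFinP; apply: measurable_funTS.
    exact: measurableT_comp.
  congr (integral _ _ _); apply/seteqP; split=> t; rewrite /Sx /= in_itv /= andbT -x0.
    by case.
  by move=> t0; split=> //; exact: ltW.
have mgamma : measurable_fun (`]0, +oo[%classic : set R)
    (fun t : R => (t `^ (1 + d%:R / 2 - 1) * expR (- t))%:E).
  apply/measurable_EFinP; apply: measurable_funM.
    apply: measurable_funTS; exact: measurable_powR.
  apply: measurable_funTS; apply: (measurableT_comp (@measurable_expR R)).
  exact: oppr_measurable.
rewrite fub -ge0_integralZl//.
rewrite [RHS]integral_mkcond; apply: eq_integral => t _.
rewrite patchE; case: ifPn => [|t0]; last first.
  apply: integral0_eq => x _; rewrite /f indicE memNset ?mulr0//.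
  move=> [_ /= t1]; move: t0; rewrite notin_setE /= in_itv /= andbT.
  exact.
rewrite inE /= in_itv /= andbT => t0.
transitivity (\int[lebesgue R d]_x
  ((expR (- t))%:E * (\1_(eball d (Num.sqrt t)) x)%:E))%E.
  apply: eq_integral => x _; rewrite /f EFinM /= !indicE; congr (_ * _%:R%:E)%E.
  congr nat_of_bool; apply/idP/idP => /set_mem xS; apply/mem_set; move: xS.
    by move=> [/= xt _]; rewrite /eball /= (enorm_le _ (sqrtr_ge0 _)) sqr_sqrtr ?(ltW t0).
  by rewrite /eball /S /= (enorm_le _ (sqrtr_ge0 _)) sqr_sqrtr ?(ltW t0).
have mb : measurable (eball d (Num.sqrt t)) by apply: measurable_eball; exact: sqrtr_ge0.
rewrite ge0_integralZl//; last first.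
  exact/measurable_EFinP/measurable_indic.
  rewrite integral_indic// setIT.
  transitivity ((expR (- t))%:E *
      ((Num.sqrt t ^+ d)%:E * lebesgue R d (eball d 1)))%E.
    by congr (_ * _)%E; apply: lebesgue_eball; rewrite sqrtr_gt0.
  rewrite addrAC subrr add0r -(powR12_sqrt (ltW t0)) -powR_mulrn ?powR_ge0//.
  by rewrite -powRrM (mulrC 2^-1) muleA -EFinM muleC (mulrC (expR _)).
by move=> t _; rewrite lee_fin mulr_ge0 ?powR_ge0 ?expR_ge0.
Qed.

Lemma gamma_integral_ge0 d : (0 <= gamma_integral d)%E.
Proof.
by apply: integral_ge0 => t _; rewrite lee_fin mulr_ge0 ?powR_ge0 ?expR_ge0.
Qed.

(** The product of the two quantities is the positive real number sqrt(pi)^d, so neither of them can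
    be zero or infinite. *)
Lemma lebesgue_eball1_gamma d : 0 < Gamma (1 + d%:R / 2 : R) /\
  lebesgue R d (eball d 1) =
    (Num.sqrt pi ^+ d / Gamma (1 + d%:R / 2))%:E.
Proof.
have -> : Gamma (1 + d%:R / 2) = fine (gamma_integral d) by [].
have pi0 : 0 < Num.sqrt pi ^+ d :> R by rewrite exprn_gt0// sqrtr_gt0 pi_gt0.
have := gauss_ball_volume d.
have := gamma_integral_ge0 d.
have : (0 <= lebesgue R d (eball d 1))%E by exact: measure_ge0.
case: (lebesgue R d (eball d 1)) => [v| |]//; last first.
  case: (gamma_integral d) => [g| |] _ //.
  rewrite lee_fin le_eqVlt => /predU1P[<-|g0].
    by rewrite mule0 => -[/eqP]; rewrite eq_sym gt_eqF.
  by rewrite gt0_mulye ?lte_fin.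
rewrite lee_fin => v0.
case: (gamma_integral d) => [g| |]//=; last first.
  move: v0; rewrite le_eqVlt => /predU1P[<-|v0].
    by rewrite mul0e => _ -[/eqP]; rewrite eq_sym gt_eqF.
  by rewrite gt0_muley ?lte_fin.
rewrite lee_fin => g0; rewrite -EFinM => -[vg].
have gN0 : g != 0 by apply: contraTneq pi0 => g00; rewrite -vg g00 mulr0 ltxx.
by split; [rewrite lt_neqAle eq_sym gN0|rewrite -vg mulfK].
Qed.

Lemma lebesgue_eballE d (r : R) : 0 < r ->
  lebesgue R d (eball d r) = (omega d r)%:E.
Proof.
move=> r0; have [_ Vd] := lebesgue_eball1_gamma d.
rewrite lebesgue_eball// Vd -EFinM /omega mulrC -powR12_sqrt ?pi_ge0//.
by rewrite -(powR_mulrn d (powR_ge0 pi 2^-1)) -powRrM (mulrC 2^-1).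
Qed.

Lemma omega_gt0 d (r : R) : 0 < r -> 0 < omega d r.
Proof.
move=> r0; have [G0 _] := lebesgue_eball1_gamma d.
by rewrite mulr_gt0 ?exprn_gt0// divr_gt0// powR_gt0// pi_gt0.
Qed.

End ball_volume.

(** * Periodization *)

Section lattice.
Context (R : realType) (d : nat) (s : R).
Hypothesis s0 : 0 < s.
Local Notation K := {ffun 'I_d -> int}.
Local Notation lam := (lebesgue R d).

(** Lattice vectors are indexed by finite functions, which form a countable type, so that unions
    over the lattice are countable. *)
Definition lat (k : K) : d.-tuple R := [tuple (k i)%:~R * s | i < d].

(** Half-open, unlike the box of the torus, so that each lattice orbit meets it exactly once. *)
Definition cell : set (d.-tuple R) :=
  box (fun=> `[- (s / 2), s / 2[%classic).

(** The preimage in R^d of the image of A in the torus. *)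
Definition orbit_set (A : set (d.-tuple R)) : set (d.-tuple R) :=
  [set z | exists k, A (taff 1 (lat k) z)].

Lemma tnth_taff_lat (k : K) z i :
  tnth (taff 1 (lat k) z) i = tnth z i + (k i)%:~R * s.
Proof. by rewrite !tnth_mktuple mul1r. Qed.

Lemma taff_latK (k : K) z : taff 1 (lat (- k)) (taff 1 (lat k) z) = z.
Proof.
by apply: eq_from_tnth => i; rewrite !tnth_taff_lat ffunE; ring.
Qed.

Lemma taff_latD (k l : K) z :
  taff 1 (lat l) (taff 1 (lat k) z) = taff 1 (lat (k + l)) z.
Proof.
apply: eq_from_tnth => i; rewrite !tnth_taff_lat ffunE intrD; ring.
Qed.

Lemma ex_cell1 (u : R) : exists k : int, - (s / 2) <= u + k%:~R * s < s / 2.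
Proof.
exists (- Num.floor (u / s + 1 / 2)); rewrite intrN.
have /andP[] := floor_itv (u / s + 1 / 2).
rewrite intrD -(ler_pM2r s0) -(ltr_pM2r s0) !mulrDl mulfVK ?gt_eqF//.
by move=> f1 f2; apply/andP; split; lra.
Qed.

Lemma small_mulint (k : int) : `|k%:~R * s| < s -> k = 0.
Proof.
rewrite normrM (gtr0_norm s0) gtr_pMl// -intr_norm -[ltRHS]/(1%:~R) ltr_int.
by case: k => [[|k]|k].
Qed.

(** The translate in [-s/2, s/2) is the one: any other differs from it by at least s, hence has
    modulus at least s/2. *)
Lemma nearest1 (u : R) : exists k : int, forall m : int,
  `|u + k%:~R * s| <= `|u + m%:~R * s|.
Proof.
have [k /andP[k1 k2]] := ex_cell1 u; exists k => m.
have [->//|mk] := eqVneq m k.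
have : s <= `|(m - k)%:~R * s|.
  rewrite leNgt; apply/negP => /small_mulint/eqP; rewrite subr_eq0.
  by move/negP: mk.
have -> : (m - k)%:~R * s = (u + m%:~R * s) - (u + k%:~R * s).
  by rewrite intrB; ring.
have uk : `|u + k%:~R * s| <= s / 2 by rewrite ler_norml k1 ltW.
move=> /le_trans/(_ (ler_normB _ _)); lra.
Qed.

Lemma ex_cell z : exists k, cell (taff 1 (lat k) z).
Proof.
have [k kP] := choice (fun i => ex_cell1 (tnth z i)).
exists [ffun i => k i] => i; rewrite tnth_taff_lat ffunE /= in_itv /=.
exact: kP.
Qed.

Lemma cell_inj z k l :
  cell (taff 1 (lat k) z) -> cell (taff 1 (lat l) z) -> k = l.
Proof.
move=> zk zl; apply/ffunP => i.
have := zk i; have := zl i.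
rewrite !tnth_taff_lat /= !in_itv /= => /andP[l1 l2] /andP[k1 k2].
apply/eqP; rewrite -subr_eq0; apply/eqP/small_mulint.
by rewrite ltr_norml intrB; apply/andP; split; nra.
Qed.

Lemma measurable_cell : measurable cell.
Proof. by apply: measurable_box => i; exact: measurable_itv. Qed.

Lemma measurable_preimage_taff (t : d.-tuple R) (A : set (d.-tuple R)) :
  measurable A -> measurable (taff 1 t @^-1` A).
Proof.
by move=> mA; rewrite -[X in measurable X]setTI; exact: measurable_taff.
Qed.

(** If A injects into the torus, a periodic function has the same integral over A and over its image
    in the fundamental cell: cut A along the translates of the cell and move every piece back. *)
Lemma ge0_integral_cell (A : set (d.-tuple R)) (h : d.-tuple R -> \bar R) :
  measurable A ->
  (forall z k, A z -> A (taff 1 (lat k) z) -> k = 0) ->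
  measurable_fun setT h -> (forall z, 0 <= h z)%E ->
  (forall k z, h (taff 1 (lat k) z) = h z) ->
  (\int[lam]_(z in cell `&` orbit_set A) h z = \int[lam]_(z in A) h z)%E.
Proof.
move=> mA secA mh h0 perh.
(* [F] lists the pieces of A and [G] the same pieces moved into the cell. Numbers that code no
   lattice vector give empty pieces. *)
pose F n : set (d.-tuple R) := if @pickle_inv K n is Some k
  then A `&` (taff 1 (lat k) @^-1` cell) else set0.
pose G n : set (d.-tuple R) := if @pickle_inv K n is Some k
  then cell `&` (taff 1 (lat (- k)) @^-1` A) else set0.
have mF n : measurable (F n).
  rewrite /F; case: pickle_inv => // k; apply: measurableI => //.
  by apply: measurable_preimage_taff; exact: measurable_cell.
have mG n : measurable (G n).
  rewrite /G; case: pickle_inv => // k; apply: measurableI => //.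
    exact: measurable_cell.
  exact: measurable_preimage_taff.
have pickleE (k : K) : @pickle_inv K (choice.pickle k) = Some k by exact: pickleK_inv.
have pinj m n k : @pickle_inv K m = Some k -> @pickle_inv K n = Some k -> m = n.
  move=> mk nk; have := @pickle_invK K m; have := @pickle_invK K n.
  by rewrite /ocancel mk nk /= => <- <-.
have UF : A = \bigcup_n F n.
  apply/seteqP; split=> [z Az|z [n _]]; last first.
    by rewrite /F; case: pickle_inv => // k [].
  have [k zk] := ex_cell z.
  by exists (choice.pickle k) => //; rewrite /F pickleE.
have UG : cell `&` orbit_set A = \bigcup_n G n.
  apply/seteqP; split=> [z [zQ [k Azk]]|z [n _]]; last first.
    by rewrite /G; case: pickle_inv => // k [zQ Az]; split=> //; exists (- k).
  by exists (choice.pickle (- k)) => //; rewrite /G pickleE opprK.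
have tF : trivIset setT F.
  move=> m n _ _ [z []]; rewrite /F.
  case mk : pickle_inv => [k|]// [_ zk].
  case nl : pickle_inv => [l|]// [_ zl].
  by rewrite -(cell_inj zk zl) in nl; exact: pinj mk nl.
have tG : trivIset setT G.
  move=> m n _ _ [z []]; rewrite /G.
  case mk : pickle_inv => [k|]// [_ zk].
  case nl : pickle_inv => [l|]// [_ zl].
  suff kl : k = l by rewrite -kl in nl; exact: pinj mk nl.
  have := secA _ (k - l) zk; rewrite taff_latD addrA addNr add0r => /(_ zl) /eqP.
  by rewrite subr_eq0 => /eqP.
rewrite UG [in RHS]UF !ge0_integral_bigcup//; [|exact: measurable_funTS|exact: measurable_funTS].
apply: eq_eseriesr => n _; rewrite /F /G.
case: pickle_inv => [k|]; last by rewrite !integral_set0.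
rewrite integral_mkcond [RHS]integral_mkcond.
rewrite -(ge0_integral_translate (lat k)).
- apply: eq_integral => z _; rewrite !patchE perh.
  congr (if _ then _ else _); apply/idP/idP => /set_mem H; apply/mem_set; move: H;
  by rewrite /= taff_latK => -[].
- apply/measurable_restrict => //; last exact: measurable_funTS.
  apply: measurableI; first exact: measurable_cell.
  exact: measurable_preimage_taff.
- by move=> z; rewrite patchE; case: ifP.
Qed.

End lattice.

Lemma measurable_exists (disp : measure_display) (T : measurableType disp)
    (K : countType) (F : K -> set T) :
  (forall k, measurable (F k)) -> measurable [set z | exists k, F k z].
Proof.
move=> mF; rewrite (_ : mkset _ =
    \bigcup_n (if choice.unpickle n is Some k then F k else set0)).
  by apply: bigcupT_measurable => n; case: choice.unpickle.
apply/seteqP; split=> z /= [k].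
  by move=> Fkz; exists (choice.pickle k) => //; rewrite choice.pickleK.
by move=> _; case: choice.unpickle => // l Flz; exists l.
Qed.

Lemma measurable_preimage_snd (d1 d2 : measure_display)
    (T1 : measurableType d1) (T2 : measurableType d2) (A : set T2) :
  measurable A -> measurable [set z : T1 * T2 | A z.2].
Proof.
move=> mA; rewrite (_ : mkset _ = setT `*` A); first exact: measurableX.
by apply/seteqP; split=> z // [].
Qed.

(** * Neighborhoods on the torus and uniform points *)

Section torus.
Context (R : realType) (d n : nat) (rad : R).
Hypothesis n0 : (0 < n)%N.
Hypothesis rad0 : 0 < rad.
Local Notation s := (side R d n).
Local Notation lam := (lebesgue R d).
Hypothesis rads : 3 * rad < s.

Let s0 : 0 < s. Proof. by rewrite powR_gt0// ltr0n. Qed.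

Definition tball (x : d.-tuple R) : set (d.-tuple R) :=
  [set y | enorm (tsub x y) <= rad].

Definition near_set (x : d.-tuple R) : set (d.-tuple R) :=
  [set y | torus_dist n x y <= rad].

(** The infimum is attained: every coordinate is minimized separately by [nearest1]. *)
Lemma torus_dist_le (x y : d.-tuple R) (r : R) :
  (torus_dist n x y <= r) <->
  exists k : {ffun 'I_d -> int}, enorm (tsub x (taff 1 (lat s k) y)) <= r.
Proof.
have E (k : {ffun 'I_d -> int}) : enorm (tsub x (taff 1 (lat s k) y)) =
    enorm [tuple tnth x i - tnth y i + ((- k)%R i)%:~R * s | i < d].
  congr enorm; apply: eq_from_tnth => i.
  rewrite [LHS]tnth_mktuple tnth_taff_lat tnth_mktuple ffunE; ring.
split.
- move=> xyr.
  have [k kP] := choice (fun i => nearest1 s0 (tnth x i - tnth y i)).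
  exists (- [ffun i => k i]); rewrite E opprK.
  apply: le_trans xyr; apply: lb_le_inf.
    by eexists; exists (fun=> 0).
  move=> _ [m _ <-]; apply: ler_wsqrtr; apply: ler_sum => i _.
  rewrite !tnth_mktuple ffunE -[leLHS]real_normK ?num_real//.
  by rewrite -[leRHS]real_normK ?num_real// lerXn2r ?nnegrE.
- move=> [k]; rewrite E; apply: le_trans; apply: ge_inf.
    by exists 0 => _ [m _ <-]; exact: sqrtr_ge0.
  by exists (- k).
Qed.

Lemma near_setE x : near_set x = orbit_set s (tball x).
Proof. by apply/seteqP; split=> y /torus_dist_le. Qed.

Lemma tnth_tsub (x y : d.-tuple R) i : tnth (tsub x y) i = tnth x i - tnth y i.
Proof. by rewrite tnth_mktuple. Qed.

Lemma coord_le (x : d.-tuple R) i : `|tnth x i| <= enorm x.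
Proof.
rewrite -sqrtr_sqr; apply: ler_wsqrtr.
by rewrite (bigD1 i)//= lerDl sumr_ge0// => j _; exact: sqr_ge0.
Qed.

Lemma enorm_tsubC (x y : d.-tuple R) : enorm (tsub x y) = enorm (tsub y x).
Proof.
congr Num.sqrt; apply: eq_bigr => i _.
by rewrite !tnth_tsub -sqrrN opprB.
Qed.

(** Two points of one ball differ by at most 2 R in each coordinate, which is less than a period:
    the ball injects into the torus. *)
Lemma tball_lat0 x y k : tball x y -> tball x (taff 1 (lat s k) y) -> k = 0.
Proof.
move=> xy xyk; apply/ffunP => i; rewrite ffunE; apply: (small_mulint s0).
have := le_trans (coord_le _ i) xy; have := le_trans (coord_le _ i) xyk.
rewrite !tnth_tsub tnth_taff_lat !ler_norml ltr_norml.
move: rads rad0 ((k i)%:~R * s) => + + c; move: s (tnth _ _) => t u.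
by move=> ? ? /andP[? ?] /andP[? ?]; apply/andP; split; lra.
Qed.

(** Inside one ball, nearness on the torus is Euclidean nearness. A lattice shift between y and z
    would be a sum of three differences of size at most R, which 3 R < s forbids. *)
Lemma tball_near x y z : tball x y -> tball x z ->
  near_set y z <-> tball y z.
Proof.
move=> xy xz; rewrite near_setE; split=> [[k]|yz]; last first.
  exists 0; rewrite /tball /= (_ : taff _ _ _ = z)//.
  by apply: eq_from_tnth => i; rewrite tnth_taff_lat ffunE mul0r addr0.
move=> yzk; suff k0 : k = 0.
  move: yzk; rewrite k0 (_ : taff _ _ _ = z)//.
  by apply: eq_from_tnth => i; rewrite tnth_taff_lat ffunE mul0r addr0.
apply/ffunP => i; rewrite ffunE; apply: (small_mulint s0).
have := le_trans (coord_le _ i) xy; have := le_trans (coord_le _ i) xz.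
have := le_trans (coord_le _ i) yzk.
rewrite !tnth_tsub tnth_taff_lat !ler_norml ltr_norml.
move: rads rad0 ((k i)%:~R * s) => + + c; move: s (tnth _ _) => t u.
by move=> ? ? /andP[? ?] /andP[? ?] /andP[? ?]; apply/andP; split; lra.
Qed.

Lemma near_set_lat x y k : near_set x (taff 1 (lat s k) y) <-> near_set x y.
Proof.
rewrite near_setE; split=> -[l].
  by rewrite taff_latD => ?; exists (k + l).
move=> xy; exists (l - k); rewrite taff_latD.
by rewrite addrC subrK.
Qed.

Lemma near_setC x y : near_set x y <-> near_set y x.
Proof.
suff H u v : near_set u v -> near_set v u by split; exact: H.
rewrite !near_setE => -[k ukv]; exists (- k); rewrite /tball /= enorm_tsubC.
move: ukv; rewrite /tball /= (_ : tsub u _ = tsub (taff 1 (lat s (- k)) u) v)//.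
by apply: eq_from_tnth => i; rewrite !tnth_tsub !tnth_taff_lat ffunE; ring.
Qed.

Lemma measurable_tball_prod :
  measurable [set z : d.-tuple R * d.-tuple R | tball z.1 z.2].
Proof.
rewrite (_ : mkset _ = [set z | sqnorm (tsub z.1 z.2) <= rad ^+ 2]).
  rewrite -[X in measurable X]setTI.
  have mf : measurable_fun setT
      (fun z : d.-tuple R * d.-tuple R => sqnorm (tsub z.1 z.2)).
    apply: (measurableT_comp (@measurable_sqnorm R d)).
    apply/measurable_fun_tnthP => i.
    rewrite (_ : _ \o _ = fun z => tnth z.1 i - tnth z.2 i); last first.
      by apply/funext => z /=; rewrite tnth_tsub.
    apply: measurable_funB.
      exact: (measurableT_comp (measurable_tnth i) measurable_fst).
    exact: (measurableT_comp (measurable_tnth i) measurable_snd).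
  have := mf measurableT _ (measurable_itv `]-oo, (rad ^+ 2)]).
  by rewrite set_itvE.
by apply/seteqP; split=> z; rewrite /tball /= (enorm_le _ (ltW rad0)).
Qed.

Lemma measurable_tball x : measurable (tball x).
Proof.
have := measurable_xsection x measurable_tball_prod.
by congr measurable; apply/seteqP; split=> y; rewrite /xsection /= inE.
Qed.

Lemma measurable_lebesgue_tballI (B : set (d.-tuple R)) : measurable B ->
  measurable_fun setT (fun y => lam (B `&` tball y)).
Proof.
move=> mB.
have mN : measurable [set w : d.-tuple R * d.-tuple R | B w.2 /\ tball w.1 w.2].
  exact: (measurableI _ _ (measurable_preimage_snd mB) measurable_tball_prod).
rewrite (_ : (fun _ => _) = lam \o xsection
    [set w : d.-tuple R * d.-tuple R | B w.2 /\ tball w.1 w.2]).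
  exact: measurable_fun_xsection.
apply/funext => y /=; congr (lam _).
by apply/seteqP; split=> w; rewrite /xsection /= inE.
Qed.

Lemma measurable_near_prod :
  measurable [set z : d.-tuple R * d.-tuple R | near_set z.1 z.2].
Proof.
rewrite (_ : mkset _ = [set z | exists k, tball z.1 (taff 1 (lat s k) z.2)]).
  apply: measurable_exists => k.
  rewrite -[X in measurable X]setTI.
  have mf : measurable_fun setT (fun z : d.-tuple R * d.-tuple R =>
      (z.1, taff 1 (lat s k) z.2)).
    apply: measurable_fun_pair; first exact: measurable_fst.
    exact: (measurableT_comp (measurable_taff _ _) measurable_snd).
  exact: (mf measurableT _ measurable_tball_prod).
by apply/seteqP; split=> z /torus_dist_le.
Qed.

Lemma measurable_near_set x : measurable (near_set x).
Proof.
have := measurable_xsection x measurable_near_prod.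
by congr measurable; apply/seteqP; split=> y; rewrite /xsection /= inE.
Qed.

Lemma lebesgue_tball x : lam (tball x) = (omega d rad)%:E.
Proof.
rewrite -lebesgue_eballE// -(lebesgue_taff x ltr01 (measurable_tball x)).
rewrite expr1n mul1e.
suff -> : taff 1 x @^-1` tball x = eball d rad by [].
apply/seteqP; split=> y; rewrite /tball /eball /=;
  rewrite enorm_tsubC (_ : tsub _ _ = y)//;
  by apply: eq_from_tnth => i; rewrite tnth_tsub !tnth_mktuple; ring.
Qed.

(** The double integral in [p_conn] before normalization, with the inner integral written as a
    volume. *)
Definition pconn_integral : \bar R :=
  (\int[lam]_(u in eball d rad) lam (eball d rad `&` tball u))%E.

Lemma measurable_torus_box : measurable (torus_box d n : set (d.-tuple R)).
Proof.
rewrite (_ : torus_box d n = box (fun=> `[- (s / 2), s / 2]%classic)).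
  by apply: measurable_box => i; exact: measurable_itv.
apply/seteqP; split=> x xs i.
  by have := xs i; rewrite /= in_itv /= -ler_norml.
by have := xs i; rewrite /= in_itv /= -ler_norml.
Qed.

Lemma cell_torus_box : cell s `<=` (torus_box d n : set (d.-tuple R)).
Proof.
move=> x xs i; have := xs i; rewrite /= in_itv /= => /andP[x1 x2].
by rewrite ler_norml x1 ltW.
Qed.

(** The difference is covered by the d faces on which a coordinate equals s/2, and each face is a
    box with a null side. *)
Lemma lebesgue_torus_boundary :
  lam (torus_box d n `\` cell s) = 0%E.
Proof.
pose face i : set (d.-tuple R) :=
  box (fun j => if j == i then [set s / 2] else setT).
have mface i : measurable (face i).
  by apply: measurable_box => j; case: ifP => _ //; exact: measurable_set1.
have face0 i : lam (face i) = 0%E.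
  rewrite lebesgue_box; last by move=> j; case: ifP.
  by rewrite (bigD1 i)//= eqxx lebesgue_measure_set1 mul0e.
have [mU U0] : measurable (\big[setU/set0]_(i < d) face i) /\
    lam (\big[setU/set0]_(i < d) face i) = 0%E.
  apply: (big_ind (fun A => measurable A /\ lam A = 0%E)) => //.
  move=> A B [mA A0] [mB B0]; split; first exact: measurableU.
  exact: null_set_setU.
apply: (subset_measure0 _ _ _ U0) => //.
  by apply: measurableD; [exact: measurable_torus_box|exact: measurable_cell].
move=> x [xs xc]; rewrite -bigcup_seq.
have [i xi] : exists i, tnth x i = s / 2.
  apply: contrapT => /forallNP xN; apply: xc => i; rewrite /= in_itv /=.
  have := xs i; rewrite ler_norml => /andP[-> x2] /=.
  by rewrite lt_neqAle x2 andbT; apply/eqP/xN.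
exists i; first by rewrite /= mem_index_enum.
by move=> j; case: eqP => [->|].
Qed.

Section uniform.
Variable m : probability (d.-tuple R) R.
Hypothesis mE : forall A, measurable A ->
  (m A = (n%:R^-1)%:E * lam (A `&` torus_box d n))%E.

Lemma uniform_integral (f : d.-tuple R -> \bar R) :
  measurable_fun setT f -> (forall x, 0 <= f x)%E ->
  (\int[m]_x f x = (n%:R^-1)%:E * \int[lam]_(x in cell s) f x)%E.
Proof.
move=> mf f0.
have mc := @measurable_cell R d s.
have m0 : m (~` cell s) = 0%E.
  rewrite mE; last exact: measurableC.
  by rewrite setIC -setDE lebesgue_torus_boundary mule0.
rewrite (ge0_negligible_integral (measurableC mc) measurableT mf _ m0)//.
rewrite setTD setCK.
have n1 : 0 <= n%:R^-1 :> R by [].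
rewrite (@eq_measure_integral _ _ _ _ (mscale (NngNum n1) lam)).
  rewrite ge0_integral_mscale//; exact: measurable_funTS.
move=> A mA Ac; apply: (etrans (mE mA)); rewrite setIidl//.
by apply: subset_trans Ac _; exact: cell_torus_box.
Qed.

(** The torus neighborhood of x is the orbit of a Euclidean ball, so no case distinction is needed
    for points near the boundary of the box. *)
Lemma uniform_periodic x (h : d.-tuple R -> \bar R) :
  measurable_fun setT h -> (forall x, 0 <= h x)%E ->
  (forall k z, h (taff 1 (lat s k) z) = h z) ->
  (\int[m]_(y in near_set x) h y = (n%:R^-1)%:E * \int[lam]_(y in tball x) h y)%E.
Proof.
move=> mh h0 hp.
rewrite integral_mkcond uniform_integral; last first.
- by move=> y; rewrite patchE; case: ifP.
- apply/measurable_restrict => //; first exact: measurable_near_set.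
  exact: measurable_funTS.
congr (_ * _)%E; rewrite -(ge0_integral_cell s0 (measurable_tball x)) //.
  by rewrite [RHS]integral_mkcondr near_setE.
by move=> z k; exact: tball_lat0.
Qed.

Lemma uniform_nearI x B : measurable B ->
  (forall k z, B (taff 1 (lat s k) z) <-> B z) ->
  (m (near_set x `&` B) = (n%:R^-1)%:E * lam (tball x `&` B))%E.
Proof.
move=> mB Bp.
have := @uniform_periodic x (fun z => (\1_B z)%:E) _ _ _.
rewrite !integral_indic//; last 2 first.
- exact: measurable_tball.
- exact: measurable_near_set.
rewrite ![B `&` _]setIC; apply.
- exact/measurable_EFinP/measurable_indic.
- by move=> z; rewrite lee_fin.
- move=> k z; rewrite !indicE; congr (_%:R%:E); congr nat_of_bool.
  by apply/idP/idP => /set_mem/Bp/mem_set.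
Qed.

Lemma uniform_near x : m (near_set x) = (omega d rad / n%:R)%:E.
Proof.
rewrite -[near_set x]setIT uniform_nearI// setIT lebesgue_tball -EFinM.
by rewrite mulrC.
Qed.

Lemma near_near_lat x k z :
  near_set (taff 1 (lat s k) x) z <-> near_set x z.
Proof.
apply: (iff_trans (near_setC _ _)); apply: (iff_trans (near_set_lat _ _ _)).
exact: near_setC.
Qed.

(** Both neighborhoods are unfolded into the ball around x, where [tball_near] makes the third
    nearness condition Euclidean; a translation then moves x to 0. *)
Lemma uniform_triangle x :
  (\int[m]_(y in near_set x) m (near_set x `&` near_set y) =
   (n%:R^-1)%:E * ((n%:R^-1)%:E * pconn_integral))%E.
Proof.
rewrite uniform_periodic; last 3 first.
- have mN : measurable [set z : d.-tuple R * d.-tuple R |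
      near_set x z.2 /\ near_set z.1 z.2].
    exact: (measurableI _ _ (measurable_preimage_snd (measurable_near_set x))
      measurable_near_prod).
  rewrite (_ : (fun _ => _) = m \o xsection [set z : d.-tuple R * d.-tuple R |
      near_set x z.2 /\ near_set z.1 z.2]).
    exact: measurable_fun_xsection.
  apply/funext => y /=; congr (m _).
  by apply/seteqP; split=> z; rewrite /xsection /= inE.
- by move=> y; exact: measure_ge0.
- move=> k y; congr (m (_ `&` _)); apply/seteqP; split=> z;
  exact: (near_near_lat y k z).1 || exact: (near_near_lat y k z).2.
congr (_ * _)%E.
transitivity (\int[lam]_(y in tball x)
    ((n%:R^-1)%:E * lam (tball x `&` tball y)))%E.
  apply: eq_integral => y /set_mem xy.
  rewrite uniform_nearI; last 2 first.
  - exact: measurable_near_set.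
  - by move=> k z; exact: near_set_lat.
  congr (_ * lam _)%E; apply/seteqP; split=> z [xz yz]; split=> //.
    exact/(tball_near xy xz).
  exact/(tball_near xy xz).
have mg z := measurable_lebesgue_tballI (measurable_tball z).
rewrite ge0_integralZl//; last 2 first.
- exact: measurable_tball.
- exact: measurable_funTS.
congr (_ * _)%E.
rewrite integral_mkcond -(ge0_integral_translate x); last 2 first.
- apply/measurable_restrict => //; first exact: measurable_tball.
  exact: measurable_funTS.
- by move=> y; rewrite patchE; case: ifP.
rewrite /pconn_integral [RHS]integral_mkcond; apply: eq_integral => u _.
have xE (v : d.-tuple R) : tball x (taff 1 x v) <-> eball d rad v.
  rewrite /tball /eball /= enorm_tsubC (_ : tsub _ _ = v)//.
  by apply: eq_from_tnth => i; rewrite tnth_tsub !tnth_mktuple; ring.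
have uE (v : d.-tuple R) : tball (taff 1 x u) (taff 1 x v) <-> tball u v.
  rewrite /tball /= (_ : tsub _ _ = tsub u v)//.
  by apply: eq_from_tnth => i; rewrite !tnth_tsub !tnth_mktuple; ring.
rewrite !patchE.
rewrite (_ : (taff 1 x u \in tball x) = (u \in eball d rad)); last first.
  by apply/idP/idP => /set_mem/xE/mem_set.
case: ifP => // _.
have := lebesgue_taff x ltr01 (measurableI _ _ (measurable_tball x)
  (measurable_tball (taff 1 x u))).
rewrite expr1n mul1e => <-; congr (lam _).
by apply/seteqP; split=> v /= [/xE ? /uE ?].
Qed.

End uniform.
End torus.

(** [p_conn] is built from real-valued integrals, so both layers have to be finite: the inner one is
    at most omega, the outer one at most omega^2. *)
Lemma pconn_integralE (R : realType) (d : nat) (rad : R) : 0 < rad ->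
  pconn_integral d rad = (omega d rad ^+ 2 * p_conn d rad)%:E.
Proof.
move=> rad0.
have w0 : omega d rad != 0 by rewrite gt_eqF// omega_gt0.
have mb : measurable (eball d rad) := measurable_eball (ltW rad0).
have le x : (lebesgue R d (eball d rad `&` tball rad x) <= (omega d rad)%:E)%E.
  rewrite -lebesgue_eballE//; apply: le_measure; rewrite ?inE//.
  by apply: measurableI => //; exact: (measurable_tball rad0).
have fin x : lebesgue R d (eball d rad `&` tball rad x) \is a fin_num.
  by rewrite ge0_fin_numE ?measure_ge0//; apply: le_lt_trans (le x) (ltry _).
rewrite /p_conn mulrA divff ?expf_eq0// mul1r /Rintegral.
have E : pconn_integral d rad =
    (\int[lebesgue R d]_(x in eball d rad) (fine (\int[lebesgue R d]_(y in eball d rad)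
       ((enorm (tsub x y) <= rad)%R%:R)%:E))%:E)%E.
  apply: eq_integral => x _.
  transitivity (\int[lebesgue R d]_(y in eball d rad) (\1_(tball rad x) y)%:E)%E.
    rewrite integral_indic//; [by rewrite setIC|exact: measurable_tball].
  rewrite -[LHS]fineK.
    congr (fine _)%:E; apply: eq_integral => y _; rewrite indicE; congr (_%:R%:E).
    by congr nat_of_bool; apply/idP/idP => [/set_mem|/mem_set].
  by rewrite integral_indic//; [rewrite setIC; exact: fin|exact: measurable_tball].
rewrite -E fineK// ge0_fin_numE; last first.
  by apply: integral_ge0 => x _; exact: measure_ge0.
apply: (@le_lt_trans _ _ (\int[lebesgue R d]_(x in eball d rad) (cst (omega d rad)%:E x))%E).
  apply: ge0_le_integral => //.
  by apply: measurable_funTS; exact: measurable_lebesgue_tballI.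
by rewrite integral_cst// [X in (_ * X)%E](lebesgue_eballE d rad0) -EFinM ltry.
Qed.

(** * Independence *)

Section independence.
Context (R : realType) (disp d1 d2 : measure_display).
Context (T : measurableType disp) (T1 : measurableType d1)
  (T2 : measurableType d2).
Variable P : probability T R.
Local Open Scope ereal_scope.

Definition independent (Z1 : T -> T1) (Z2 : T -> T2) :=
  forall A B, measurable A -> measurable B ->
  P (Z1 @^-1` A `&` Z2 @^-1` B) = P (Z1 @^-1` A) * P (Z2 @^-1` B).

(** The joint law is the product of the two laws, by uniqueness on rectangles, and Tonelli applies
    to it. *)
Lemma independent_integral (Z1 : {RV P >-> T1}) (Z2 : {RV P >-> T2})
    (f : T1 * T2 -> \bar R) :
  independent Z1 Z2 -> measurable_fun setT f -> (forall z, 0 <= f z) ->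
  \int[P]_w f (Z1 w, Z2 w) = \int[P]_w \int[distribution P Z2]_y f (Z1 w, y).
Proof.
move=> ind mf f0.
have mZ : measurable_fun setT (fun w => (Z1 w, Z2 w)).
  by apply: measurable_fun_pair.
transitivity (\int[pushforward P (fun w => (Z1 w, Z2 w))]_z f z).
  by rewrite ge0_integral_pushforward.
rewrite (@eq_measure_integral _ _ _ _ (distribution P Z1 \x distribution P Z2)%E).
  rewrite fubini_tonelli1// ge0_integral_distribution//.
    exact: measurable_fun_fubini_tonelli_F.
  by move=> y; exact: integral_ge0.
move=> A mA _; apply/esym.
apply: (product_measure_unique (m' :=
  measure_function_pushforward__canonical__measure_function_Measure P mZ)) => //.
Qed.

End independence.

(** In A, both sides are finite measures that agree on a generating family stable under
    intersection. Used once for each of two variables, this reduces independence to generators. *)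
Lemma independent_generated (R : realType) (disp d1 : measure_display)
    (T : measurableType disp) (T1 : measurableType d1) (P : probability T R)
    (Z : T -> T1) (C : set (set T1)) (B : set T) :
  measurable_fun setT Z -> @measurable _ T1 = <<s C >> -> setI_closed C ->
  C setT -> measurable B ->
  (forall A, C A -> P (Z @^-1` A `&` B) = P (Z @^-1` A) * P B)%E ->
  forall A, measurable A -> (P (Z @^-1` A `&` B) = P (Z @^-1` A) * P B)%E.
Proof.
move=> mZ CE CI CT mB CB A; rewrite CE => sA.
have PB0 : 0 <= fine (P B) by rewrite fine_ge0.
pose m1 := measure_function_pushforward__canonical__measure_function_Measure
  (mrestr P mB) mZ.
pose m2 := mscale (NngNum PB0)
  (measure_function_pushforward__canonical__measure_function_Measure P mZ).
have m2E D : m2 D = (P (Z @^-1` D) * P B)%E.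
  by rewrite /m2 /mscale /= fineK ?fin_num_measure// muleC.
rewrite -m2E.
apply: (@g_sigma_algebra_measure_unique _ _ _ C _ (fun=> setT) _ _ m1 m2) => //.
- by move=> D CD; rewrite CE; exact: sub_sigma_algebra.
- by rewrite bigcup_const.
- by move=> D CD; apply: (etrans _ (esym (m2E D))); exact: CB.
- move=> k; rewrite /m1 /= /pushforward /mrestr preimage_setT setTI.
  by rewrite (le_lt_trans (probability_le1 P mB))// ltry.
Qed.

Section coordinates.
Context (R : realType) (disp dE : measure_display) (T : measurableType disp)
  (E : measurableType dE) (P : probability T R) (n : nat) (x0 : E).
Variable X : 'I_n -> {RV P >-> E}.
Hypothesis Xind : forall A : 'I_n -> set E, (forall i, measurable (A i)) ->
  P [set w | forall i, A i (X i w)] = (\prod_(i < n) P (X i @^-1` A i))%E.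

(* Default values outside S, so that restrictions to disjoint sets of indices
   are independent but still tuples of the same type. *)
Definition coord_restr (S : {set 'I_n}) (w : T) : n.-tuple E :=
  [tuple if i \in S then X i w else x0 | i < n].

Lemma tnth_coord_restr S w i :
  tnth (coord_restr S w) i = if i \in S then X i w else x0.
Proof. by rewrite tnth_mktuple. Qed.

Lemma measurable_coord_restr S : measurable_fun setT (coord_restr S).
Proof.
apply/measurable_fun_tnthP => i.
rewrite (_ : _ \o _ = fun w => if i \in S then X i w else x0); last first.
  by apply/funext => w; rewrite /= tnth_coord_restr.
by case: (i \in S).
Qed.

Lemma measurable_prop (Q : Prop) : measurable [set _ : E | Q].
Proof.
have [q|q] := pselect Q.
  by rewrite (_ : mkset _ = setT)//; apply/seteqP; split.
by rewrite (_ : mkset _ = set0)//; apply/seteqP; split.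
Qed.

(** Covers the coordinates at which a restriction takes its default value: an event of a constant is
    empty or everything, hence independent of any other. *)
Lemma probability_setI_prop (A : set E) (i : 'I_n) (Q : Prop) : measurable A ->
  (P (X i @^-1` (A `&` [set _ | Q])) =
   P (X i @^-1` A) * P (X i @^-1` [set _ | Q]))%E.
Proof.
move=> mA; have [q|q] := pselect Q.
  by rewrite (_ : [set _ : E | Q] = setT) ?setIT ?preimage_setT ?probability_setT ?mule1//;
    apply/seteqP; split.
by rewrite (_ : [set _ : E | Q] = set0) ?setI0 ?preimage_set0 ?measure0 ?mule0//;
  apply/seteqP; split.
Qed.

Lemma coord_restr_box S (A : 'I_n -> set E) :
  coord_restr S @^-1` box A = [set w | forall i,
    (if i \in S then A i else [set _ | A i x0]) (X i w)].
Proof.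
apply/seteqP; split=> w Aw i; have := Aw i; rewrite tnth_coord_restr;
by case: ifP.
Qed.

(** For boxes both sides are products over i, and at each i one of the two factors concerns only the
    default value. *)
Lemma independent_coord_restr S :
  independent P (coord_restr S) (coord_restr (~: S)).
Proof.
have boxbox A B : boxes A -> boxes B ->
    (P (coord_restr S @^-1` A `&` coord_restr (~: S) @^-1` B) =
     P (coord_restr S @^-1` A) * P (coord_restr (~: S) @^-1` B))%E.
  move=> [{}A mA ->] [{}B mB ->]; rewrite !coord_restr_box.
  have mif (D : {set 'I_n}) (C : 'I_n -> set E) : (forall i, measurable (C i)) ->
      forall i, measurable (if i \in D then C i else [set _ | C i x0]).
    by move=> mC i; case: ifP => // _; exact: measurable_prop.
  rewrite (Xind (mif S A mA)) (Xind (mif (~: S) B mB)) -big_split /=.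
  have mC i := measurableI _ _ (mif S A mA i) (mif (~: S) B mB i).
  transitivity (\prod_(i < n) P (X i @^-1`
      ((if i \in S then A i else [set _ | A i x0]) `&`
       (if i \in ~: S then B i else [set _ | B i x0]))))%E.
    rewrite -Xind//; congr (P _); apply/seteqP; split=> w /=.
      by move=> [Aw Bw] i; split; [exact: Aw|exact: Bw].
    by move=> ABw; split=> i; have [] := ABw i.
  apply: eq_bigr => i _; rewrite finset.in_setC; case: ifP => _ /=.
    exact: probability_setI_prop.
  by rewrite setIC muleC; exact: probability_setI_prop.
have mpre D B : measurable B -> measurable (coord_restr D @^-1` B).
  by move=> mB; rewrite -[X in measurable X]setTI; exact: measurable_coord_restr.
move=> A B mA mB; apply: (independent_generated (C := @boxes _ E n)) => //.
- exact: measurable_coord_restr.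
- exact: measurable_boxesE.
- exact: setI_closed_boxes.
- exact: boxesT.
- exact: mpre.
move=> {mA}A bA; rewrite setIC muleC.
have mA : measurable A by case: bA => C mC ->; exact: measurable_box.
apply: (independent_generated (C := @boxes _ E n)) => //.
- exact: measurable_coord_restr.
- exact: measurable_boxesE.
- exact: setI_closed_boxes.
- exact: boxesT.
- exact: mpre.
by move=> {mB}B bB; rewrite setIC muleC; exact: boxbox.
Qed.

End coordinates.

(** * Nearness of positions: disjoint sets of indices, leaves and triangles *)

Section closeness.
Context (R : realType) (d n : nat) (rad : R).
Context (disp : measure_display) (T : measurableType disp).
Variable P : probability T R.
Variable X : 'I_n -> {RV P >-> d.-tuple R}.
Hypothesis n0 : (0 < n)%N.
Hypothesis rad0 : 0 < rad.
Hypothesis rads : 3 * rad < side R d n.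
Hypothesis Xunif : forall i (A : set (d.-tuple R)), measurable A ->
  distribution P (X i) A = ((n%:R^-1)%:E * lebesgue R d (A `&` torus_box d n))%E.
Hypothesis Xind : forall A : 'I_n -> set (d.-tuple R),
  (forall i, measurable (A i)) ->
  P [set w | forall i, A i (X i w)] = (\prod_(i < n) P (X i @^-1` A i))%E.

Local Notation near := (near_set n rad).

Definition close_set (D : seq ('I_n * 'I_n)) : set (n.-tuple (d.-tuple R)) :=
  [set x | forall e, e \in D -> near (tnth x e.1) (tnth x e.2)].

Definition close_event (D : seq ('I_n * 'I_n)) : set T :=
  [set w | forall e, e \in D -> near (X e.1 w) (X e.2 w)].

Lemma close_set_cons e D x :
  close_set (e :: D) x <-> near (tnth x e.1) (tnth x e.2) /\ close_set D x.
Proof.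
split=> [H|[He HD] f].
  by split=> [|f fD]; apply: H; rewrite inE ?eqxx ?fD ?orbT.
by rewrite inE => /predU1P[->//|]; exact: HD.
Qed.

Lemma measurable_near_tnth (i j : 'I_n) :
  measurable [set x : n.-tuple (d.-tuple R) | near (tnth x i) (tnth x j)].
Proof.
rewrite -[X in measurable X]setTI.
have mf : measurable_fun setT
    (fun x : n.-tuple (d.-tuple R) => (tnth x i, tnth x j)).
  by apply: measurable_fun_pair; exact: measurable_tnth.
exact: (mf measurableT _ (measurable_near_prod n0 rad0)).
Qed.

Lemma measurable_close_set D : measurable (close_set D).
Proof.
elim: D => [|e D IH].
  by rewrite (_ : close_set _ = setT)//; apply/seteqP; split.
rewrite (_ : close_set _ =
  [set x | near (tnth x e.1) (tnth x e.2)] `&` close_set D).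
  by apply: measurableI => //; exact: measurable_near_tnth.
by apply/seteqP; split=> x /close_set_cons.
Qed.

Let x0 : d.-tuple R := [tuple 0 | i < d].
Local Notation Y := (coord_restr x0 X).

Definition within (S : {set 'I_n}) (D : seq ('I_n * 'I_n)) :=
  forall e, e \in D -> (e.1 \in S) && (e.2 \in S).

Lemma close_eventE S D : within S D -> close_event D = Y S @^-1` close_set D.
Proof.
by move=> SD; apply/seteqP; split=> w H e eD; have := H e eD;
  have /andP[e1 e2] := SD e eD; rewrite !tnth_coord_restr e1 e2.
Qed.

Lemma measurable_close_event D : measurable (close_event D).
Proof.
rewrite (@close_eventE finset.setT)//; last by move=> e _; rewrite !inE.
rewrite -[X in measurable X]setTI.
exact: (measurable_coord_restr x0 X _ measurableT (measurable_close_set D)).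
Qed.

Lemma close_event_cat S D1 D2 : within S D1 -> within (~: S) D2 ->
  (P (close_event (D1 ++ D2)) = P (close_event D1) * P (close_event D2))%E.
Proof.
move=> SD1 SD2; rewrite (close_eventE SD1) (close_eventE SD2).
rewrite -(independent_coord_restr x0 Xind)//; try exact: measurable_close_set.
rewrite -(close_eventE SD1) -(close_eventE SD2); congr (P _).
apply/seteqP; split=> w => [H|[H1 H2] e].
  by split=> e eD; apply: H; rewrite mem_cat eD ?orbT.
by rewrite mem_cat => /orP[]; [exact: H1|exact: H2].
Qed.

Let Z S : {RV P >-> n.-tuple (d.-tuple R)} :=
  mfun_Sub (mem_set (measurable_coord_restr x0 X S)).

Lemma independent_coord (S : {set 'I_n}) (j : 'I_n) : j \notin S -> independent P (Z S) (X j).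
Proof.
move=> jS A B mA mB.
have E : X j @^-1` B = Y (~: S) @^-1` ((@tnth n _)^~ j @^-1` B).
  by apply/seteqP; split=> w /=; rewrite tnth_coord_restr finset.in_setC jS.
rewrite E; apply: (independent_coord_restr x0 Xind) => //.
by rewrite -[X in measurable X]setTI; exact: measurable_tnth.
Qed.

Lemma measurable_close_near D i :
  measurable [set z : n.-tuple (d.-tuple R) * d.-tuple R |
    close_set D z.1 /\ near (tnth z.1 i) z.2].
Proof.
have mf : measurable_fun setT
    (fun z : n.-tuple (d.-tuple R) * d.-tuple R => (tnth z.1 i, z.2)).
  apply: measurable_fun_pair => //.
  exact: (measurableT_comp (measurable_tnth i) measurable_fst).
rewrite (_ : mkset _ = (close_set D `*` setT) `&`
    (setT `&` (fun z : n.-tuple (d.-tuple R) * d.-tuple R => (tnth z.1 i, z.2))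
      @^-1` [set z | near z.1 z.2])).
  apply: measurableI.
    by apply: measurableX => //; exact: measurable_close_set.
  exact: (mf measurableT _ (measurable_near_prod n0 rad0)).
by apply/seteqP; split=> z /= [] // [? ?] [].
Qed.

Lemma probability_coord_near (j : 'I_n) (x : d.-tuple R) :
  distribution P (X j) (near x) = (omega d rad / n%:R)%:E.
Proof. by apply: uniform_near => // A mA; exact: Xunif. Qed.

(** Fix all positions except that of j, which occurs in the pair (i, j) only. Wherever i lies, its
    neighborhood has probability exactly omega / n. *)
Lemma close_event_leaf (D : seq ('I_n * 'I_n)) (i j : 'I_n) :
  i != j -> within (~: [set j]%SET) D ->
  (P (close_event ((i, j) :: D)) =
   (omega d rad / n%:R)%:E * P (close_event D))%E.
Proof.
move=> ij SD; pose S := (~: [set j])%SET.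
have jS : j \notin S by rewrite !inE eqxx.
have iS : i \in S by rewrite !inE.
pose M := [set z : n.-tuple (d.-tuple R) * d.-tuple R |
  close_set D z.1 /\ near (tnth z.1 i) z.2].
have mM : measurable M := measurable_close_near D i.
have mD := measurable_close_event.
transitivity (\int[P]_w (\1_M (Z S w, X j w))%:E)%E.
  rewrite -[X in P X = _]setIT -integral_indic//.
  apply: eq_integral => w _; rewrite !indicE; congr (_%:R%:E).
  congr nat_of_bool; apply/idP/idP => /set_mem H; apply/mem_set; move: H.
    move=> H; split; last first.
      by have := H (i, j) (mem_head _ _); rewrite /= tnth_coord_restr iS.
    suff : close_event D w by rewrite (close_eventE SD).
    by move=> e eD; apply: H; rewrite inE eD orbT.
  move=> [/= HD]; rewrite tnth_coord_restr iS => ijw e.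
  rewrite inE => /predU1P[->//|]; move: e.
  by change (close_event D w); rewrite (close_eventE SD).
rewrite (independent_integral (f := fun z => (\1_M z)%:E) (independent_coord jS)).
- transitivity (\int[P]_w ((omega d rad / n%:R)%:E * (\1_(close_event D) w)%:E))%E.
    apply: eq_integral => w _; rewrite (close_eventE SD) [in RHS]indicE /=.
    have [HD|HD] := pselect (close_set D (Z S w)).
      rewrite mem_set// mule1 -(probability_coord_near j (tnth (Z S w) i)).
      rewrite -[in RHS](setIT (near _)) -integral_indic//; last first.
        exact: measurable_near_set.
      apply: eq_integral => y _; rewrite !indicE; congr (_%:R%:E).
      by congr nat_of_bool; apply/idP/idP => /set_mem H; apply/mem_set => //; case: H.
    rewrite memNset// mule0; apply: integral0_eq => y _.
    by rewrite indicE memNset// => -[].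
  rewrite ge0_integralZl//.
  - rewrite integral_indic// setIT//.
  - by apply/measurable_EFinP; exact: measurable_indic.
  - by rewrite lee_fin divr_ge0// ltW// omega_gt0.
- by apply/measurable_EFinP; exact: measurable_indic.
- by move=> z; rewrite lee_fin.
Qed.

Lemma independent_pair (i j : 'I_n) : i != j -> independent P (X i) (X j).
Proof.
move=> ij A B mA mB.
have E : X i @^-1` A = Y [set i]%SET @^-1` ((@tnth n _)^~ i @^-1` A).
  by apply/seteqP; split=> w /=; rewrite tnth_coord_restr inE eqxx.
rewrite E; apply: (@independent_coord [set i]%SET) => //.
  by rewrite inE eq_sym.
by rewrite -[X in measurable X]setTI; exact: measurable_tnth.
Qed.

Lemma measurable_near_near : measurable
  [set z : (d.-tuple R * d.-tuple R) * d.-tuple R |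
    near z.1.1 z.2 /\ near z.1.2 z.2].
Proof.
have mN := @measurable_near_prod R d n rad n0 rad0.
have m1 : measurable_fun setT
    (fun z : (d.-tuple R * d.-tuple R) * d.-tuple R => (z.1.1, z.2)).
  apply: measurable_fun_pair => //.
  exact: (measurableT_comp measurable_fst measurable_fst).
have m2 : measurable_fun setT
    (fun z : (d.-tuple R * d.-tuple R) * d.-tuple R => (z.1.2, z.2)).
  apply: measurable_fun_pair => //.
  exact: (measurableT_comp measurable_snd measurable_fst).
have := measurableI _ _ (m1 measurableT _ mN) (m2 measurableT _ mN).
by rewrite !setTI.
Qed.

(** The position of l is integrated out first, then that of j; by [uniform_triangle] the result is
    the same for every position of i. *)
Lemma close_event_triangle (i j l : 'I_n) : i != j -> i != l -> j != l ->
  P (close_event [:: (i, j); (i, l); (j, l)]) =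
  (omega d rad ^+ 2 * p_conn d rad / n%:R ^+ 2)%:E.
Proof.
move=> ij il jl; pose S := (~: [set l])%SET.
have lS : l \notin S by rewrite !inE eqxx.
have iS : i \in S by rewrite !inE.
have jS : j \in S by rewrite !inE.
(* The condition on (i, j) is repeated so that M is an intersection of two sets covered by
   [measurable_close_near]. *)
pose M := [set z : n.-tuple (d.-tuple R) * d.-tuple R |
  (close_set [:: (i, j)] z.1 /\ near (tnth z.1 i) z.2) /\
  (close_set [:: (i, j)] z.1 /\ near (tnth z.1 j) z.2)].
have mM : measurable M by apply: measurableI; exact: measurable_close_near.
have mD := measurable_close_event.
(* The law of [X j] stands in for that of [X l]: the two are equal, and [uniform_triangle] is about
   a single law. *)
pose g (z : d.-tuple R * d.-tuple R) : \bar R :=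
  ((\1_[set z | near z.1 z.2] z)%:E *
   distribution P (X j) (near z.1 `&` near z.2))%E.
have mg : measurable_fun setT g.
  apply: emeasurable_funM.
    apply/measurable_EFinP; apply: measurable_indic.
    exact: measurable_near_prod.
  rewrite (_ : (fun _ => _) = distribution P (X j) \o
      xsection [set z : (d.-tuple R * d.-tuple R) * d.-tuple R |
        near z.1.1 z.2 /\ near z.1.2 z.2]).
    by apply: measurable_fun_xsection; exact: measurable_near_near.
  apply/funext => y /=; congr (distribution P (X j) _).
  by apply/seteqP; split=> z; rewrite /xsection /= inE.
have g0 z : (0 <= g z)%E by rewrite mule_ge0// lee_fin.
transitivity (\int[P]_w (\1_M (Z S w, X l w))%:E)%E.
  rewrite -[X in P X = _]setIT -integral_indic//.
  apply: eq_integral => w _; rewrite !indicE; congr (_%:R%:E).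
  congr nat_of_bool; apply/idP/idP => /set_mem H; apply/mem_set; move: H.
    move=> H; have Hij := H (i, j) (mem_head _ _).
    have Hil := H (i, l); have Hjl := H (j, l).
    have HY : close_set [:: (i, j)] (Y S w).
      by move=> e; rewrite inE => /eqP->; rewrite !tnth_coord_restr iS jS.
    rewrite /M /= !tnth_coord_restr iS jS; split; split=> //.
      by apply: Hil; rewrite !inE eqxx orbT.
    by apply: Hjl; rewrite !inE eqxx !orbT.
  rewrite /M /= !tnth_coord_restr iS jS => -[[HY Hil] [_ Hjl]] e.
  rewrite !inE => /or3P[] /eqP-> //=.
  by have := HY (i, j) (mem_head _ _); rewrite !tnth_coord_restr iS jS.
rewrite (independent_integral (f := fun z => (\1_M z)%:E) (independent_coord lS)).
- transitivity (\int[P]_w g (X i w, X j w))%E.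
    apply: eq_integral => w _; rewrite /g indicE /=.
    have [H|H] := pselect (near (X i w) (X j w)).
      rewrite mem_set// mul1e.
      transitivity (distribution P (X l) (near (X i w) `&` near (X j w))).
        rewrite -[X in _ = _ X]setIT -integral_indic//; last first.
          by apply: measurableI; exact: measurable_near_set.
        apply: eq_integral => y _; rewrite !indicE; congr (_%:R%:E).
        congr nat_of_bool; apply/idP/idP => /set_mem H'; apply/mem_set; move: H'.
          by rewrite /M /= !tnth_coord_restr iS jS => -[[_ ?] [_ ?]].
        move=> [? ?]; rewrite /M /= !tnth_coord_restr iS jS.
        by split; split=> // e; rewrite inE => /eqP->;
          rewrite !tnth_coord_restr iS jS.
      by rewrite !Xunif//; apply: measurableI; exact: measurable_near_set.
    rewrite memNset// mul0e; apply: integral0_eq => y _.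
    rewrite indicE memNset// => -[[/= HY _] _].
    by have := HY (i, j) (mem_head _ _); rewrite !tnth_coord_restr iS jS.
  rewrite (independent_integral (f := g) (independent_pair ij))//.
  transitivity (\int[P]_w cst (omega d rad ^+ 2 * p_conn d rad / n%:R ^+ 2)%:E w)%E.
    apply: eq_integral => w _.
    transitivity (\int[distribution P (X j)]_(y in near (X i w))
        distribution P (X j) (near (X i w) `&` near y))%E.
      rewrite [RHS]integral_mkcond; apply: eq_integral => y _.
      rewrite patchE /g indicE /=; case: ifPn => [/set_mem H|H].
        by rewrite mem_set// mul1e.
      by rewrite memNset ?mul0e//; move: H; rewrite notin_setE.
    rewrite uniform_triangle//; last by move=> A mA; exact: Xunif.
    by rewrite pconn_integralE// -!EFinM; congr EFin; field; rewrite pnatr_eq0 -lt0n.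
  by rewrite integral_cst// [X in (_ * X)%E]probability_setT mule1.
- by apply/measurable_EFinP; exact: measurable_indic.
- by move=> z; rewrite lee_fin.
Qed.

End closeness.

(** * Edges given the positions *)

(** With independent choices of weight c and 1 - c, the pairs of U outside D contribute a total
    factor 1 each. *)
Lemma sum_sets_between (R : comPzRingType) (I : finType) (U D : {set I})
    (c : I -> R) : D \subset U ->
  \sum_(E : {set I} | (D \subset E) && (E \subset U))
    \prod_(e in U) (if e \in E then c e else 1 - c e) = \prod_(e in D) c e.
Proof.
move=> DU.
(* [F] is the weight of having e in the set and [H] that of not having it; a zero in either one
   enforces an inclusion. *)
pose F e := if e \in U then c e else 0.
pose H e := if e \in D then 0 else if e \in U then 1 - c e else 1.
transitivity (\prod_e (F e + H e)); last first.
  rewrite [RHS]big_mkcond; apply: eq_bigr => e _; rewrite /F /H.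
  have [/(fintype.subsetP DU)->|eD] := boolP (e \in D); first by rewrite addr0.
  by case: ifP => _; rewrite ?add0r// addrC subrK.
rewrite bigA_distr [LHS]big_mkcond; apply: eq_big => // E _.
case: ifPn => [/andP[/fintype.subsetP DE /fintype.subsetP EU]|].
  rewrite big_mkcond; apply: eq_bigr => e _; rewrite /F /H.
  have [eE|eE] := boolP (e \in E); first by rewrite EU.
  case: (boolP (e \in D)) => [/DE eE'|_]; first by rewrite eE' in eE.
  by case: ifP.
rewrite negb_and => /orP[/fintype.subsetPn[e eD eE]|/fintype.subsetPn[e eE eU]].
  by rewrite (bigD1 e)//= (negbTE eE) /H eD mul0r.
by rewrite (bigD1 e)//= eE /F (negbTE eU) mul0r.
Qed.

Lemma probability_fibers (R : realType) (disp : measure_display)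
    (T : measurableType disp) (P : probability T R) (F : finType) (Y : T -> F)
    (Q : pred F) : (forall a, measurable [set w | Y w = a]) ->
  P [set w | Q (Y w)] = (\sum_(a | Q a) P [set w | Y w = a])%E.
Proof.
move=> mY.
have memY (s : seq F) : uniq s -> measurable [set w | Y w \in s] /\
    P [set w | Y w \in s] = (\sum_(a <- s) P [set w | Y w = a])%E.
  elim: s => [_|a s IH /= /andP[aNs us]].
    rewrite big_nil (_ : mkset _ = set0) ?measure0//.
    by apply/seteqP; split.
  have [ms sE] := IH us.
  have E : [set w | Y w \in a :: s] =
      [set w | Y w = a] `|` [set w | Y w \in s].
    by apply/seteqP; split=> w /= => [|H]; [move/predU1P|apply/predU1P].
  split; first by rewrite E; exact: measurableU.
  rewrite big_cons -sE E measureU//.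
  by apply/seteqP; split=> w //= [->]; rewrite (negbTE aNs).
rewrite -big_filter.
have [_ <-] := memY _ (filter_uniq Q (index_enum_uniq F)).
by congr (P _); apply/seteqP; split=> w /=; rewrite mem_filter mem_index_enum andbT.
Qed.

Lemma measurable_fiber_set (disp : measure_display) (T : measurableType disp)
    (I : finType) (Y : T -> {set I}) : (forall e, measurable [set w | e \in Y w]) ->
  forall E, measurable [set w | Y w = E].
Proof.
move=> mY E.
rewrite (_ : mkset _ = \big[setI/setT]_(e : I) [set w | (e \in Y w) = (e \in E)]).
  apply: bigsetI_measurable => e _.
  have [eE|eE] := boolP (e \in E); first exact: mY.
  rewrite (_ : mkset _ = ~` [set w | e \in Y w]); first exact: measurableC.
  apply/seteqP; split=> w /=; first by move=> ->.
  by move=> /negP/negbTE.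
apply/seteqP; split=> w /=.
  by move=> <-; rewrite -bigcap_seq => e _ /=.
rewrite -bigcap_seq => H; apply/setP => e.
by apply: (H e); rewrite /= mem_index_enum.
Qed.

Section edges.
Context (R : realType) (d n : nat) (p rad : R).
Context (disp : measure_display) (T : measurableType disp).
Variable P : probability T R.
Variables (X : 'I_n -> {RV P >-> d.-tuple R}) (G : T -> sgraph 'I_n).
Hypothesis rgg : is_RGG p rad X G.
Hypothesis n0 : (0 < n)%N.
Hypothesis rad0 : 0 < rad.
Hypothesis rads : 3 * rad < side R d n.
Hypothesis p0 : 0 < p.
Hypothesis p1 : p <= 1.

Local Notation VV := ('I_n * 'I_n)%type.

Definition upper : {set VV} := [set e : VV | (e.1 < e.2)%N].

Definition upper_edges (w : T) : {set VV} :=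
  [set e : VV | (e.1 < e.2)%N && adj (G w) e.1 e.2].

Definition set_adj (E : {set VV}) : rel 'I_n := fun i j =>
  (i < j)%N && ((i, j) \in E) || (j < i)%N && ((j, i) \in E).

Lemma set_adj_sym E : symmetric (set_adj E).
Proof. by move=> i j; rewrite /set_adj orbC. Qed.

Lemma set_adj_irrefl E : irreflexive (set_adj E).
Proof. by move=> i; rewrite /set_adj ltnn. Qed.

(** [rgg_edges] speaks of graphs, so a set of increasing pairs has to be turned into one. *)
Definition graph_of (E : {set VV}) : sgraph 'I_n :=
  SGraph (set_adj_sym E) (@set_adj_irrefl E).

Lemma upper_edgesE (E : {set VV}) : E \subset upper ->
  [set w | upper_edges w = E] = [set w | adj (G w) =2 adj (graph_of E)].
Proof.
move=> /fintype.subsetP EU; apply/seteqP; split=> w /=.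
  move=> <- i j; rewrite /set_adj !inE /=.
  case: ltngtP => ij /=; first by rewrite orbF.
    by rewrite adj_sym.
  by rewrite (ord_inj ij) adj_irrefl.
move=> wE; apply/setP => -[i j]; rewrite !inE /= wE /= /set_adj.
case: ltngtP => ij /=; first by rewrite orbF.
  by apply/esym/negP => /EU; rewrite inE /= ltnNge ltnW.
by apply/esym/negP => /EU; rewrite inE /= ij ltnn.
Qed.

Lemma measurable_upper_edges (E : {set VV}) :
  measurable [set w | upper_edges w = E].
Proof.
apply: measurable_fiber_set => e.
have [eU|eU] := boolP (e \in upper).
  rewrite (_ : mkset _ = [set w | adj (G w) e.1 e.2]).
    exact: (rgg_measurable rgg).
  by move: eU; rewrite inE => eU; apply/seteqP; split=> w /=; rewrite inE eU.
rewrite (_ : mkset _ = set0)//.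
by move: eU; rewrite inE => /negbTE eU; apply/seteqP; split=> w //=; rewrite inE eU.
Qed.

Lemma connect_prob_ge0 w i j : 0 <= connect_prob p rad X w i j.
Proof. by apply: mulr_ge0; [exact: ltW|exact: ler0n]. Qed.

Lemma connect_prob_le1 w i j : connect_prob p rad X w i j <= 1.
Proof.
rewrite /connect_prob; case: (torus_dist _ _ _ <= _); rewrite ?mulr1 ?mulr0//.
Qed.

Lemma measurable_near_event (i j : 'I_n) :
  measurable [set w | near_set n rad (X i w) (X j w)].
Proof.
have := measurable_close_event X n0 rad0 [:: (i, j)].
congr (measurable _); apply/seteqP; split=> w H; first exact: (H (i, j) (mem_head _ _)).
by move=> e; rewrite inE => /eqP ->.
Qed.

Lemma measurable_connect_prob (i j : 'I_n) :
  measurable_fun setT (fun w => connect_prob p rad X w i j).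
Proof.
apply: measurable_funM => //.
rewrite (_ : (fun _ => _) = \1_[set w | near_set n rad (X i w) (X j w)]).
  exact/measurable_indic/measurable_near_event.
apply/funext => w; rewrite indicE; congr (_%:R); congr nat_of_bool.
by apply/idP/idP => [H|/set_mem//]; exact/mem_set.
Qed.

Lemma probability_upper_edges (E : {set VV}) : E \subset upper ->
  (P [set w | upper_edges w = E] =
   \int[P]_w (\prod_(e in upper) (if e \in E then connect_prob p rad X w e.1 e.2
     else 1 - connect_prob p rad X w e.1 e.2))%:E)%E.
Proof.
move=> EU; have := rgg_edges rgg (graph_of E) measurableT.
rewrite preimage_setT setTI upper_edgesE// => ->.
apply: eq_integral => w _; congr EFin.
rewrite pair_big_dep /=.
apply: eq_big => [e|e /= ij]; first by rewrite inE.
by rewrite /set_adj ij /= ltnNge ltnW//= orbF; case: e ij.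
Qed.

(** Sum the conditional law over all edge sets that contain D. Given the positions, this leaves the
    product of the connection probabilities over D, which is p^|D| if all these pairs are near and 0
    otherwise. *)
Lemma upper_edges_superset (D : {set VV}) : D \subset upper ->
  P [set w | D \subset upper_edges w] =
  ((p ^+ #|D|)%:E * P (close_event rad X (enum D)))%E.
Proof.
move=> DU.
rewrite (probability_fibers P (fun E : {set VV} => D \subset E) measurable_upper_edges).
pose c w (e : VV) := connect_prob p rad X w e.1 e.2.
pose f (E : {set VV}) w : R :=
  \prod_(e in upper) (if e \in E then c w e else 1 - c w e).
have f0 E w : 0 <= f E w.
  apply: prodr_ge0 => e _; case: ifP => _; first exact: connect_prob_ge0.
  by rewrite subr_ge0; exact: connect_prob_le1.
have mf E : measurable_fun setT (f E).
  rewrite (_ : f E = fun w => \prod_(e <- enum upper)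
      (if e \in E then c w e else 1 - c w e)).
    2: by apply/funext => w; rewrite big_enum.
  apply: measurable_prod => e _; case: (e \in E).
    exact: measurable_connect_prob.
  by apply: measurable_funB => //; exact: measurable_connect_prob.
transitivity (\sum_(E : {set VV} | (D \subset E) && (E \subset upper))
    \int[P]_w (f E w)%:E)%E.
  rewrite (bigID (fun E : {set VV} => E \subset upper))/=.
  rewrite [X in (_ + X)%E]big1 ?adde0.
    by apply: eq_bigr => E /andP[_ EU]; exact: probability_upper_edges.
  move=> E /andP[_ EU]; rewrite (_ : mkset _ = set0) ?measure0//.
  apply/seteqP; split=> w //= wE; move/negP: EU; apply.
  by rewrite -wE; apply/fintype.subsetP => e; rewrite !inE => /andP[].
rewrite -big_filter -ge0_integral_sum//; last 2 first.
- by move=> E; apply/measurable_EFinP; exact: mf.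
- by move=> E w _; rewrite lee_fin.
transitivity (\int[P]_w ((p ^+ #|D|)%:E * (\1_(close_event rad X (enum D)) w)%:E))%E.
  apply: eq_integral => w _; rewrite big_filter sumEFin sum_sets_between// -EFinM.
  congr EFin; rewrite /c /connect_prob big_split /= prodr_const; congr (_ * _).
  rewrite indicE; have [H|H] := pselect (close_event rad X (enum D) w).
    rewrite mem_set// big1// => e eD.
    by have := H e; rewrite mem_enum => /(_ eD); rewrite /near_set /= => ->.
  rewrite memNset//.
  have [e eD eN] : exists2 e, e \in D & ~ near_set n rad (X e.1 w) (X e.2 w).
    apply: contrapT => HN; apply: H => e; rewrite mem_enum => eD.
    by apply: contrapT => eN; apply: HN; exists e.
  by rewrite (bigD1 e)//=; move/negP/negbTE : eN => ->; rewrite mul0r.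
have mc := measurable_close_event X n0 rad0 (enum D).
rewrite ge0_integralZl//.
- by rewrite integral_indic// setIT.
- by apply/measurable_EFinP; exact: measurable_indic.
- by rewrite lee_fin exprn_ge0// ltW.
Qed.

Local Notation flip e := (e.2, e.1).

Definition adj_event (L : seq VV) : set T :=
  [set w | all (fun e => adj (G w) e.1 e.2) L].

(** A list may repeat a pair or contain both of its orientations; the power of p counts distinct
    unordered pairs. *)
Definition upper_pairs (L : seq VV) : {set VV} :=
  [set e : VV | (e.1 < e.2)%N && ((e \in L) || (flip e \in L))].

(** A loop is never an edge although a point is always near itself, so lists with loops are treated
    apart. *)
Definition loopless (L : seq VV) := all (fun e => e.1 != e.2) L.

Lemma upper_pairs_sub L : upper_pairs L \subset upper.
Proof. by apply/fintype.subsetP => e; rewrite !inE => /andP[]. Qed.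

Lemma loopless_upper_pairs L (e : VV) : loopless L -> e \in L ->
  (e \in upper_pairs L) || (flip e \in upper_pairs L).
Proof.
move=> /allP nL eL; have := nL e eL; case: e eL => i j eL /= ij.
rewrite !inE /= eL /= !orbT !andbT.
by move: ij; rewrite -(inj_eq val_inj) neq_ltn.
Qed.

Lemma adj_event_upper L : loopless L ->
  adj_event L = [set w | upper_pairs L \subset upper_edges w].
Proof.
move=> nL; apply/seteqP; split=> w /=.
  move=> /allP H; apply/fintype.subsetP => e.
  rewrite !inE => /andP[-> /orP[/H//|/H]] /=.
  by rewrite adj_sym.
move=> /fintype.subsetP H; apply/allP => e /(loopless_upper_pairs nL) /orP[]/H.
  by rewrite !inE => /andP[].
by rewrite !inE => /andP[_]; rewrite adj_sym.
Qed.

Lemma close_event_upper L : loopless L ->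
  close_event rad X (enum (upper_pairs L)) = close_event rad X L.
Proof.
move=> nL; apply/seteqP; split=> w H e.
  move=> /(loopless_upper_pairs nL)/orP[]; rewrite -mem_enum => /H//.
  by move/near_setC; apply.
rewrite mem_enum !inE => /andP[_ /orP[/H//|/H]] /=.
by move/near_setC; apply.
Qed.

Lemma loop_adj_event L : ~~ loopless L -> adj_event L = set0.
Proof.
move=> /allPn[e eL /negbNE/eqP e12]; apply/seteqP; split=> w //= /allP/(_ e eL).
by rewrite e12 adj_irrefl.
Qed.

Lemma probability_adj_event L : loopless L ->
  (P (adj_event L) =
   (p ^+ #|upper_pairs L|)%:E * P (close_event rad X L))%E.
Proof.
move=> nL; rewrite adj_event_upper// upper_edges_superset ?close_event_upper//.
exact: upper_pairs_sub.
Qed.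

Lemma card_upper_pairs_cons e L : e.1 != e.2 -> e \notin L -> flip e \notin L ->
  #|upper_pairs (e :: L)| = #|upper_pairs L|.+1.
Proof.
move=> e12 eL feL.
have [f fE fU] : exists2 f : VV, (f == e) || (f == flip e) & (f.1 < f.2)%N.
  move: e12; rewrite -(inj_eq val_inj) neq_ltn => /orP[e12|e21].
    by exists e; rewrite ?eqxx.
  by exists (flip e); rewrite ?eqxx ?orbT.
have -> : upper_pairs (e :: L) = f |: upper_pairs L.
  apply/setP => g; rewrite !inE.
  move: fE fU; case: e {e12 eL feL} => i j; case: f => k l; case: g => a b /=.
  rewrite !xpair_eqE.
  case: (ltngtP a b) => //= ab.
  - move=> /orP[/andP[/eqP-> /eqP->]|/andP[/eqP-> /eqP->]] kl.
      suff -> : (b == i) && (a == j) = false by rewrite /= orbA.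
      by apply/negP => /andP[/eqP bi /eqP aj]; move: kl; rewrite -bi -aj ltnNge ltnW.
    suff -> : (a == i) && (b == j) = false by rewrite /= orbCA (andbC (b == i)).
    by apply/negP => /andP[/eqP bi /eqP aj]; move: kl; rewrite -bi -aj ltnNge ltnW.
  - move=> _ kl; rewrite orbF; apply/esym/negP => /andP[/eqP ak /eqP bl].
    by move: kl; rewrite -ak -bl ltnNge ltnW.
  - move=> _ kl; rewrite orbF; apply/esym/negP => /andP[/eqP ak /eqP bl].
    by move: kl; rewrite -ak -bl ab ltnn.
rewrite cardsU1 (_ : f \notin _)// inE negb_and negb_or fU /=.
by move: fE => /orP[]/eqP-> /=; rewrite ?eL ?feL //=; case: e eL {feL e12} => i j ->.
Qed.

Lemma within_notin (j : 'I_n) (L : seq VV) (e : VV) : within (~: [set j]) L ->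
  (e.1 == j) || (e.2 == j) -> e \notin L.
Proof.
move=> wL ej; apply/negP => /wL; rewrite !inE => /andP[/negbTE e1 /negbTE e2].
by move: ej; rewrite e1 e2.
Qed.

Lemma adj_event_leaf L (i j : 'I_n) : i != j -> within (~: [set j]) L ->
  (P (adj_event ((i, j) :: L)) =
   (p * omega d rad / n%:R)%:E * P (adj_event L))%E.
Proof.
move=> ij wL.
have llE : loopless ((i, j) :: L) = loopless L by rewrite /= ij.
have [nL|nL] := boolP (loopless L); last first.
  by rewrite !loop_adj_event ?llE// measure0 mule0.
rewrite !probability_adj_event ?llE//.
rewrite card_upper_pairs_cons//; try by apply: (within_notin wL); rewrite eqxx ?orbT.
rewrite (close_event_leaf n0 rad0 rads (rgg_uniform rgg) (rgg_independent rgg))//.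
rewrite !muleA -!EFinM; congr (_%:E * _)%E.
by rewrite exprS; ring.
Qed.

Lemma adj_event_cat (S : {set 'I_n}) L1 L2 :
  within S L1 -> within (~: S) L2 ->
  (P (adj_event (L1 ++ L2)) = P (adj_event L1) * P (adj_event L2))%E.
Proof.
move=> wL1 wL2.
have llE : loopless (L1 ++ L2) = loopless L1 && loopless L2.
  by rewrite /loopless all_cat.
have [nL1|nL1] := boolP (loopless L1); last first.
  by rewrite !(@loop_adj_event L1, @loop_adj_event (L1 ++ L2)) ?llE ?negb_and ?nL1// measure0 mul0e.
have [nL2|nL2] := boolP (loopless L2); last first.
  by rewrite !(@loop_adj_event L2, @loop_adj_event (L1 ++ L2)) ?llE ?negb_and ?nL2 ?orbT// measure0 mule0.
rewrite !probability_adj_event ?llE ?nL1 ?nL2//.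
rewrite (close_event_cat n0 rad0 (rgg_independent rgg) wL1 wL2)//.
rewrite muleACA -EFinM -exprD; congr ((p ^+ _)%:E * _)%E.
have -> : upper_pairs (L1 ++ L2) = upper_pairs L1 :|: upper_pairs L2.
  by apply/setP => e; rewrite !inE !mem_cat -andb_orr orbACA.
rewrite cardsU (_ : _ :&: _ = finset.set0) ?cards0 ?subn0//.
apply/setP => e; rewrite !inE; apply/negP => /andP[/andP[_ e1] /andP[_ e2]].
have : e.1 \in S by move: e1 => /orP[]/wL1 /andP[].
have : e.1 \in ~: S by move: e2 => /orP[]/wL2 /andP[].
by rewrite inE => /negbTE ->.
Qed.

Lemma adj_event_triangle (i j l : 'I_n) : i != j -> i != l -> j != l ->
  P (adj_event [:: (i, j); (i, l); (j, l)]) =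
  (p ^+ 3 * (omega d rad ^+ 2 * p_conn d rad) / n%:R ^+ 2)%:E.
Proof.
move=> ij il jl.
rewrite probability_adj_event /= ?ij ?il ?jl//.
rewrite (close_event_triangle n0 rad0 rads (rgg_uniform rgg) (rgg_independent rgg))//.
rewrite !card_upper_pairs_cons//; last first.
- by rewrite !inE !xpair_eqE ?(eq_sym j i) ?(eq_sym l i) ?(eq_sym l j)
    ?(negbTE ij) ?(negbTE il) ?(negbTE jl) ?andbF.
- by rewrite !inE !xpair_eqE ?(eq_sym j i) ?(eq_sym l i) ?(eq_sym l j)
    ?(negbTE ij) ?(negbTE il) ?(negbTE jl) ?andbF.
- by rewrite !inE !xpair_eqE ?(eq_sym j i) ?(eq_sym l i) ?(eq_sym l j)
    ?(negbTE ij) ?(negbTE il) ?(negbTE jl) ?andbF.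
- by rewrite !inE !xpair_eqE ?(eq_sym j i) ?(eq_sym l i) ?(eq_sym l j)
    ?(negbTE ij) ?(negbTE il) ?(negbTE jl) ?andbF.
rewrite (_ : upper_pairs [::] = finset.set0) ?cards0; last first.
  by apply/setP => e; rewrite !inE andbF.
by rewrite -EFinM; congr EFin; rewrite !mulrA.
Qed.

(** The law of the arc set, through which the counts are studied on a finite space. *)
Definition mass (A : {set VV}) : R := fine (P [set w | arcs (G w) = A]).

Lemma mass_ge0 A : 0 <= mass A.
Proof. by apply: fine_ge0; exact: measure_ge0. Qed.

Lemma probability_arcs (Q : pred {set VV}) :
  P [set w | Q (arcs (G w))] = (\sum_(A | Q A) mass A)%:E.
Proof.
have mA A : measurable [set w | arcs (G w) = A].
  apply: measurable_fiber_set => e.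
  rewrite (_ : mkset _ = [set w | adj (G w) e.1 e.2]).
    exact: (rgg_measurable rgg).
  by apply/seteqP; split=> w /=; rewrite inE.
rewrite (probability_fibers P Q mA) -sumEFin; apply: eq_bigr => A _.
by rewrite /mass fineK// fin_num_measure.
Qed.

Lemma mass_sum1 : \sum_A mass A = 1.
Proof.
have := probability_arcs predT; rewrite (_ : mkset _ = setT).
  by rewrite probability_setT => -[].
by apply/seteqP; split.
Qed.

End edges.

(* Symmetrized so as to be a graph for every A; on arcs it is adjacency. *)
Definition set_rel (n : nat) (A : {set 'I_n * 'I_n}) : rel 'I_n :=
  fun i j => ((i, j) \in A) || ((j, i) \in A).

Lemma set_rel_sym n (A : {set 'I_n * 'I_n}) : symmetric (set_rel A).
Proof. by move=> i j; rewrite /set_rel orbC. Qed.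

Lemma set_rel_arcs n (g : sgraph 'I_n) : set_rel (arcs g) =2 adj g.
Proof. by move=> i j; rewrite /set_rel !inE /= [adj g j i]adj_sym orbb. Qed.

Definition edge_prob (R : realType) (n : nat) (m : {set 'I_n * 'I_n} -> R)
    (L : seq ('I_n * 'I_n)) : R :=
  \sum_(A | all (fun e => set_rel A e.1 e.2) L) m A.

(* The three facts about edge probabilities that determine the limits: q is
   the probability of an edge, t that of a triangle. *)
Record edge_law (R : realType) (n : nat) (m : {set 'I_n * 'I_n} -> R)
    (q t : R) : Prop := EdgeLaw {
  law_ge0 : forall A, 0 <= m A ;
  law_sum1 : \sum_A m A = 1 ;
  law_leaf : forall L (i j : 'I_n), i != j -> within (~: [set j]%SET) L ->
    edge_prob m ((i, j) :: L) = q * edge_prob m L ;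
  law_cat : forall (S : {set 'I_n}) L1 L2, within S L1 -> within (~: S) L2 ->
    edge_prob m (L1 ++ L2) = edge_prob m L1 * edge_prob m L2 ;
  law_triangle : forall i j l : 'I_n, i != j -> i != l -> j != l ->
    edge_prob m [:: (i, j); (i, l); (j, l)] = t }.

Lemma rgg_edge_law (R : realType) (d n : nat) (p rad : R)
    (disp : measure_display) (T : measurableType disp) (P : probability T R)
    (X : 'I_n -> {RV P >-> d.-tuple R}) (G : T -> sgraph 'I_n) :
  is_RGG p rad X G -> (0 < n)%N -> 0 < rad -> 3 * rad < side R d n ->
  0 < p -> p <= 1 ->
  edge_law (mass P G) (p * omega d rad / n%:R)
    (p ^+ 3 * (omega d rad ^+ 2 * p_conn d rad) / n%:R ^+ 2).
Proof.
move=> rgg n0 rad0 rads p0 p1.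
have epE L : (edge_prob (mass P G) L)%:E = P (adj_event G L).
  rewrite /edge_prob -(probability_arcs rgg); congr (P _).
  by apply/seteqP; split=> w /=;
    rewrite (@eq_all _ _ (fun e => adj (G w) e.1 e.2))// => e;
    rewrite set_rel_arcs.
split.
- exact: mass_ge0.
- exact: mass_sum1 rgg.
- move=> L i j ij wL; apply: EFin_inj; rewrite EFinM !epE.
  exact: (adj_event_leaf rgg n0 rad0 rads p0 p1 ij wL).
- move=> S L1 L2 w1 w2; apply: EFin_inj; rewrite EFinM !epE.
  exact: (adj_event_cat rgg n0 rad0 p0 p1 w1 w2).
- move=> i j l ij il jl; apply: EFin_inj; rewrite epE.
  exact: (adj_event_triangle rgg n0 rad0 rads p0 p1 ij il jl).
Qed.

(** * Moments of walk and subgraph counts *)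

Section edge_law_theory.
Context (R : realType) (n : nat).
Local Notation VV := ('I_n * 'I_n)%type.
Variables (m : {set VV} -> R) (q t : R).
Hypothesis law : edge_law m q t.

Definition Ex (f : {set VV} -> R) : R := \sum_A m A * f A.

Definition all_edges (L : seq VV) (A : {set VV}) : bool :=
  all (fun e => set_rel A e.1 e.2) L.

Lemma edge_probE L : edge_prob m L = Ex (fun A => (all_edges L A)%:R).
Proof.
rewrite /edge_prob big_mkcond; apply: eq_bigr => A _; rewrite /all_edges.
by case: ifP; rewrite ?mulr1 ?mulr0.
Qed.

Lemma Ex_le f g : (forall A, f A <= g A) -> Ex f <= Ex g.
Proof.
by move=> fg; apply: ler_sum => A _; apply: ler_wpM2l => //; exact: law_ge0 law _.
Qed.

Lemma Ex_ge0 f : (forall A, 0 <= f A) -> 0 <= Ex f.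
Proof.
by move=> f0; apply: sumr_ge0 => A _; rewrite mulr_ge0//; exact: law_ge0 law _.
Qed.

Lemma Ex_sum (I : finType) (Q : pred I) (f : I -> {set VV} -> R) :
  Ex (fun A => \sum_(i | Q i) f i A) = \sum_(i | Q i) Ex (f i).
Proof.
rewrite /Ex exchange_big; apply: eq_bigr => A _; exact: mulr_sumr.
Qed.

Lemma ExZ c f : Ex (fun A => c * f A) = c * Ex f.
Proof. by rewrite mulr_sumr; apply: eq_bigr => A _; rewrite mulrCA. Qed.

Lemma ExD f g : Ex (fun A => f A + g A) = Ex f + Ex g.
Proof. by rewrite -big_split; apply: eq_bigr => A _; rewrite mulrDr. Qed.

Lemma Ex_cst c : Ex (fun=> c) = c.
Proof. by rewrite /Ex -mulr_suml (law_sum1 law) mul1r. Qed.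

Lemma edge_prob_ge0 L : 0 <= edge_prob m L.
Proof. by rewrite edge_probE; apply: Ex_ge0 => A; exact: ler0n. Qed.

Lemma edge_prob0 : edge_prob m [::] = 1.
Proof. by rewrite edge_probE Ex_cst. Qed.

(** Since a step may stay put, walks of exactly three steps include all shorter ones. *)
Definition lazy (A : {set VV}) x y : R := ((x == y) || set_rel A x y)%:R.

Lemma lazy_ge0 A x y : 0 <= lazy A x y.
Proof. exact: ler0n. Qed.

Lemma lazy_le1 A x y : lazy A x y <= 1.
Proof. by rewrite /lazy; case: (_ || _). Qed.

(* Given any edges L inside a set S of at most k vertices containing V, the
   conditional expectation of Phi is at most B. *)
Definition conditionally_bounded (k : nat) (B : R) (V : {set 'I_n})
    (Phi : {set VV} -> R) :=
  forall (S : {set 'I_n}) (L : seq VV), V \subset S -> (#|S| <= k)%N ->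
    within S L -> Ex (fun A => (all_edges L A)%:R * Phi A) <= edge_prob m L * B.

(** The next vertex z is one of the at most k vertices of S, where the step is bounded by 1, or it
    lies outside S; then (x, z) is a leaf attached to L and contributes a factor q. *)
Lemma conditionally_bounded_step (k : nat) (B : R) (V : {set 'I_n}) x
    (Phi : 'I_n -> {set VV} -> R) :
  0 <= q -> 0 <= B -> x \in V -> (forall z A, 0 <= Phi z A) ->
  (forall z, conditionally_bounded k.+1 B (z |: V) (Phi z)) ->
  conditionally_bounded k ((k%:R + n%:R * q) * B) V
    (fun A => \sum_z lazy A x z * Phi z A).
Proof.
move=> q0 B0 xV Phi0 H S L VS Sk wL.
have xS : x \in S := fintype.subsetP VS x xV.
under [X in Ex X]eq_fun do rewrite mulr_sumr.
rewrite (Ex_sum predT) (bigID (mem S)) /= mulrDl mulrDr; apply: lerD.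
  apply: (@le_trans _ _ (\sum_(z in S) edge_prob m L * B)).
    apply: ler_sum => z zS.
    apply: le_trans (H z S L _ _ wL); last 2 first.
    - by rewrite finset.subUset finset.sub1set zS.
    - exact: leq_trans Sk (leqnSn _).
    apply: Ex_le => A; rewrite ler_wpM2l// ler_piMl//; exact: lazy_le1.
  rewrite sumr_const -[leLHS]mulr_natl
    [leRHS](_ : _ = k%:R * (edge_prob m L * B)); last by ring.
  apply: ler_wpM2r; first by rewrite mulr_ge0// edge_prob_ge0.
  by rewrite ler_nat.
apply: (@le_trans _ _ (\sum_(z in ~: S) edge_prob m L * (q * B))).
  rewrite (eq_bigl (mem (~: S))); last by move=> z; rewrite !inE.
  apply: ler_sum => z; rewrite !inE => zS.
  have xz : x != z by apply: contraNneq zS => <-.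
  have wL' : within (~: [set z]%SET) L.
    by move=> e /wL; rewrite !inE => /andP[e1 e2]; apply/andP; split;
      apply/eqP => ez; move/negP: zS; rewrite -ez.
  rewrite mulrCA mulrA -(law_leaf law xz wL') .
  have wzL : within (z |: S) ((x, z) :: L).
    move=> e; rewrite inE => /predU1P[->/=|/wL].
      by rewrite !inE eqxx xS orbT.
    by rewrite !inE => /andP[-> ->]; rewrite !orbT.
  apply: le_trans (H z _ _ _ _ wzL); last 2 first.
  - exact: finset.setUS.
  - by rewrite cardsU1 zS ltnS.
  apply: Ex_le => A; rewrite /lazy (negbTE xz) mulrA -natrM mulnb /=.
  by rewrite andbC.
rewrite sumr_const -[leLHS]mulr_natl.
rewrite [leRHS](_ : _ = n%:R * (edge_prob m L * (q * B))); last by ring.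
apply: ler_wpM2r; first by rewrite !mulr_ge0// edge_prob_ge0.
by rewrite ler_nat; apply: leq_trans (max_card _) _; rewrite card_ord.
Qed.

Lemma conditionally_boundedS k B (V V' : {set 'I_n}) Phi : V \subset V' ->
  conditionally_bounded k B V Phi -> conditionally_bounded k B V' Phi.
Proof. by move=> VV' H S L VS; apply: H; exact: fintype.subset_trans VS. Qed.

(** The weight at the endpoint serves three purposes: 1 counts walks, an indicator prescribes their
    end, and a power of the count appends further walks. *)
Definition walks3 (A : {set VV}) v (Phi : 'I_n -> R) : R :=
  \sum_z1 lazy A v z1 * \sum_z2 lazy A z1 z2 * \sum_z3 lazy A z2 z3 * Phi z3.

Definition walk3_count A v : R := walks3 A v (fun=> 1).

Lemma walks3_ge0 A v Phi : (forall z, 0 <= Phi z) -> 0 <= walks3 A v Phi.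
Proof.
move=> Phi0; do 3 (apply: sumr_ge0 => ? _; apply: mulr_ge0; first exact: lazy_ge0).
exact: Phi0.
Qed.

Lemma walks3_cst A v c : walks3 A v (fun=> c) = walk3_count A v * c.
Proof.
rewrite /walk3_count /walks3 mulr_suml; apply: eq_bigr => z1 _.
rewrite -mulrA mulr_suml; congr (_ * _); apply: eq_bigr => z2 _.
rewrite -mulrA mulr_suml; congr (_ * _); apply: eq_bigr => z3 _.
by rewrite mulr1.
Qed.

(** j is the number of three-step walks still to be exposed and k bounds the number of vertices
    exposed so far; each step raises k by one. *)
Fixpoint walk_bound (c : R) (j k : nat) : R :=
  if j is j'.+1 then (k%:R + c) * ((k.+1%:R + c) * ((k.+2%:R + c) *
    walk_bound c j' k.+3)) else 1.

Lemma walk_bound_ge0 c j k : 0 <= c -> 0 <= walk_bound c j k.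
Proof.
move=> c0; elim: j k => [//|j IH k] /=.
by do 3 (apply: mulr_ge0; first exact: addr_ge0).
Qed.

Lemma walk3_count_moment v j : 0 <= q ->
  Ex (fun A => walk3_count A v ^+ j) <= walk_bound (n%:R * q) j 1.
Proof.
move=> q0; have c0 : 0 <= n%:R * q by rewrite mulr_ge0.
have W0 A : 0 <= walk3_count A v by apply: walks3_ge0.
have H k : conditionally_bounded k (walk_bound (n%:R * q) j k) [set v]%SET
    (fun A => walk3_count A v ^+ j).
  elim: j k => [|j IH] k /=.
    move=> S L _ _ _; rewrite mulr1 edge_probE; apply: Ex_le => A.
    by rewrite expr0 mulr1.
  have b0 := walk_bound_ge0 j k.+3 c0.
  (* One walk is split off and the other j become a weight at its end. They start again from v, so
     only v has to stay in the exposed set. *)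
  rewrite (_ : (fun _ => _) =
      (fun A => walks3 A v (fun=> walk3_count A v ^+ j))); last first.
    by apply/funext => A; rewrite walks3_cst exprS.
  apply: conditionally_bounded_step => //.
  - by rewrite !mulr_ge0// addr_ge0.
  - by rewrite inE.
  - move=> z A; do 2 (apply: sumr_ge0 => ? _; apply: mulr_ge0; first exact: lazy_ge0).
    by rewrite exprn_ge0.
  move=> z1; apply: conditionally_bounded_step => //.
  - by rewrite !mulr_ge0// addr_ge0.
  - by rewrite !inE eqxx.
  - move=> z A; apply: sumr_ge0 => ? _; apply: mulr_ge0; first exact: lazy_ge0.
    by rewrite exprn_ge0.
  move=> z2; apply: conditionally_bounded_step => //.
  - by rewrite !inE eqxx.
  - by move=> z A; rewrite exprn_ge0.
  move=> z3; apply: conditionally_boundedS (IH k.+3).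
  by rewrite finset.sub1set !inE eqxx !orbT.
have wl : within [set v]%SET ([::] : seq VV) by [].
have := H 1%N _ _ (fintype.subxx _) _ wl.
rewrite cards1 edge_prob0 mul1r => /(_ isT); apply: le_trans.
by apply: Ex_le => A; rewrite mul1r.
Qed.

End edge_law_theory.

(** * Second moments of the numbers of copies *)

Section patterns.
Context (R : realType) (n : nat).
Local Notation VV := ('I_n * 'I_n)%type.
Variables (m : {set VV} -> R) (q t : R).
Hypothesis law : edge_law m q t.
Hypothesis q0 : 0 <= q.
Context (k : nat) (H : seq ('I_k * 'I_k)).
Local Notation copy := {ffun 'I_k -> 'I_n}.

Definition copy_edges (f : copy) : seq VV := [seq (f e.1, f e.2) | e <- H].

Definition copies (A : {set VV}) : R :=
  \sum_(f : copy | injectiveb f) (all_edges (copy_edges f) A)%:R.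

Definition lazy_pattern (a b : 'I_k) :=
  (a == b) || ((a, b) \in H) || ((b, a) \in H).

Definition walk3_to (A : {set VV}) v x : R :=
  walks3 A v (fun z => (z == x)%:R).

Lemma walk3_to_ge0 A v x : 0 <= walk3_to A v x.
Proof. by apply: walks3_ge0 => z. Qed.

Lemma sum_walk3_to A v : \sum_x walk3_to A v x = walk3_count R A v.
Proof.
rewrite /walk3_to /walk3_count /walks3.
rewrite exchange_big; apply: eq_bigr => z1 _; rewrite -mulr_sumr; congr (_ * _).
rewrite exchange_big; apply: eq_bigr => z2 _; rewrite -mulr_sumr; congr (_ * _).
rewrite exchange_big; apply: eq_bigr => z3 _; rewrite -mulr_sumr; congr (_ * _).
by rewrite (bigD1 z3)//= eqxx big1 ?addr0// => x; rewrite eq_sym => /negbTE ->.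
Qed.

Lemma sum_ge_term (I : finType) (F : I -> R) i :
  (forall j, 0 <= F j) -> F i <= \sum_j F j.
Proof. by move=> F0; rewrite (bigD1 i)//= lerDl sumr_ge0. Qed.

Lemma walk3_to_ge1 A v z1 z2 x : (v == z1) || set_rel A v z1 ->
  (z1 == z2) || set_rel A z1 z2 -> (z2 == x) || set_rel A z2 x ->
  1 <= walk3_to A v x.
Proof.
move=> h1 h2 h3; rewrite /walk3_to /walks3.
apply: le_trans (sum_ge_term z1 _); last first.
  move=> z; do 3 (apply: mulr_ge0; [exact: lazy_ge0|]; try (apply: sumr_ge0 => ? _)).
  by [].
rewrite {1}/lazy h1 mul1r.
apply: le_trans (sum_ge_term z2 _); last first.
  move=> z; do 2 (apply: mulr_ge0; [exact: lazy_ge0|]; try (apply: sumr_ge0 => ? _)).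
  by [].
rewrite {1}/lazy h2 mul1r.
apply: le_trans (sum_ge_term x _); last first.
  by move=> z; apply: mulr_ge0; [exact: lazy_ge0|].
by rewrite /lazy h3 mul1r eqxx.
Qed.

(* The hubs of a pattern: any two vertices are joined, through their hubs, by
   a walk of length at most three. *)
Variable hub : 'I_k -> 'I_k.
Hypothesis hubP : forall a, lazy_pattern a (hub a).
Hypothesis hub_hub : forall a b, lazy_pattern (hub a) (hub b).

Lemma copy_lazy A (f : copy) a b : all_edges (copy_edges f) A ->
  lazy_pattern a b -> (f a == f b) || set_rel A (f a) (f b).
Proof.
move=> /allP fA; rewrite /lazy_pattern -orbA.
move=> /or3P[/eqP->|ab|ba]; first by rewrite eqxx.
  by rewrite (fA (f a, f b)) ?orbT//; apply/mapP; exists (a, b).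
by rewrite set_rel_sym (fA (f b, f a)) ?orbT//; apply/mapP; exists (b, a).
Qed.

Lemma lazy_pattern_sym a b : lazy_pattern a b = lazy_pattern b a.
Proof. by rewrite /lazy_pattern eq_sym -!orbA; congr (_ || _); rewrite orbC. Qed.

Lemma copy_walk A (f : copy) a b : all_edges (copy_edges f) A ->
  1 <= walk3_to A (f a) (f b).
Proof.
move=> fA; apply: (@walk3_to_ge1 _ _ (f (hub a)) (f (hub b))).
- exact: copy_lazy (hubP a).
- exact: copy_lazy (hub_hub a b).
- by apply: copy_lazy => //; rewrite lazy_pattern_sym; exact: hubP.
Qed.

(** It dominates the indicator that f is a copy through v and, being a product over the vertices of
    the pattern, factorizes when summed over all maps f. *)
Definition around A (f : copy) v : R := \prod_i walk3_to A v (f i).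

Lemma around_ge0 A f v : 0 <= around A f v.
Proof. by apply: prodr_ge0 => i _; exact: walk3_to_ge0. Qed.

Lemma around_ge1 A f a : all_edges (copy_edges f) A -> 1 <= around A f (f a).
Proof.
move=> fA; rewrite /around; apply: (big_ind (fun x => 1 <= x)) => //.
  by move=> x y x1 y1; rewrite -[1]mulr1 ler_pM.
by move=> i _; exact: copy_walk.
Qed.

Lemma sum_around A v : \sum_f around A f v = walk3_count R A v ^+ k.
Proof.
rewrite -(bigA_distr_bigA (fun _ x => walk3_to A v x)).
by rewrite prodr_const card_ord sum_walk3_to.
Qed.

Lemma copies_pair f g :
  Ex m (fun A => (all_edges (copy_edges f) A)%:R * (all_edges (copy_edges g) A)%:R)
  <= edge_prob m (copy_edges f) * edge_prob m (copy_edges g) +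
     Ex m (fun A => \sum_v around A f v * around A g v).
Proof.
have [/existsP[a /existsP[b /eqP ab]]|fg] :=
    boolP [exists a, exists b, f a == g b].
  rewrite -[leLHS]add0r; apply: lerD.
    by rewrite mulr_ge0// (edge_prob_ge0 law).
  apply: (Ex_le law) => A; rewrite -natrM mulnb.
  case: (boolP (_ && _)) => [/andP[fA gA]|_]; last first.
    by apply: sumr_ge0 => v _; rewrite mulr_ge0 ?around_ge0.
  apply: le_trans (sum_ge_term (f a) _); last first.
    by move=> v; rewrite mulr_ge0 ?around_ge0.
  by rewrite -[leLHS]mulr1 ler_pM// ?around_ge1// ab around_ge1.
rewrite -[leLHS]addr0; apply: lerD; last first.
  apply: (Ex_ge0 law) => A; apply: sumr_ge0 => v _.
  by rewrite mulr_ge0 ?around_ge0.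
have fS : within [set f a | a : 'I_k]%SET (copy_edges f).
  by move=> e /mapP[h _ ->] /=; rewrite !imset_f.
have gS : within (~: [set f a | a : 'I_k]%SET) (copy_edges g).
  have gN b : g b \in ~: [set f a | a : 'I_k]%SET.
    rewrite inE; apply/imsetP => -[a _ gf].
    by move/existsPn/(_ a)/existsPn/(_ b): fg; rewrite gf eqxx.
  by move=> e /mapP[h _ ->] /=; rewrite !gN.
rewrite -(law_cat law fS gS) edge_probE; apply: (Ex_le law) => A.
by rewrite -natrM mulnb /all_edges all_cat.
Qed.

Lemma copies_second_moment :
  Ex m (fun A => copies A ^+ 2) <=
  Ex m copies ^+ 2 + n%:R * walk_bound (n%:R * q) (k + k) 1.
Proof.
have -> : Ex m (fun A => copies A ^+ 2) =
    \sum_(f : copy | injectiveb f) \sum_(g : copy | injectiveb g)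
      Ex m (fun A => (all_edges (copy_edges f) A)%:R *
                   (all_edges (copy_edges g) A)%:R).
  under [RHS]eq_bigr do rewrite -Ex_sum.
  rewrite -Ex_sum; congr (Ex m _); apply/funext => A.
  rewrite expr2 mulr_suml; apply: eq_bigr => f _; exact: mulr_sumr.
have -> : Ex m copies ^+ 2 =
    \sum_(f : copy | injectiveb f) \sum_(g : copy | injectiveb g)
      edge_prob m (copy_edges f) * edge_prob m (copy_edges g).
  rewrite [Ex m copies]Ex_sum expr2 mulr_suml; apply: eq_bigr => f _.
  by rewrite mulr_sumr; apply: eq_bigr => g _; rewrite !edge_probE.
apply: (@le_trans _ _ (\sum_(f : copy | injectiveb f) \sum_(g : copy | injectiveb g)
      edge_prob m (copy_edges f) * edge_prob m (copy_edges g) +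
    \sum_(f : copy) \sum_(g : copy)
      Ex m (fun A => \sum_v around A f v * around A g v))).
  have E0 f g : 0 <= Ex m (fun A => \sum_v around A f v * around A g v).
    apply: (Ex_ge0 law) => A; apply: sumr_ge0 => v _.
    by rewrite mulr_ge0 ?around_ge0.
  apply: (@le_trans _ _ (\sum_(f : copy | injectiveb f) \sum_(g : copy | injectiveb g)
      (edge_prob m (copy_edges f) * edge_prob m (copy_edges g) +
       Ex m (fun A => \sum_v around A f v * around A g v)))).
    by apply: ler_sum => f _; apply: ler_sum => g _; exact: copies_pair.
  under eq_bigr do rewrite big_split /=.
  rewrite big_split /= lerD2l.
  rewrite [leRHS](bigID (fun f : copy => injectiveb f)) /=.
  apply: (@le_trans _ _ (\sum_(f : copy | injectiveb f) \sum_(g : copy)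
      Ex m (fun A => \sum_v around A f v * around A g v))).
    apply: ler_sum => f _; rewrite [leRHS](bigID (fun f : copy => injectiveb f)) /=.
    by rewrite lerDl sumr_ge0.
  by rewrite lerDl; apply: sumr_ge0 => f _; exact: sumr_ge0.
rewrite lerD2l.
(* With injectivity dropped, f and g range over all maps and each of the k + k vertices contributes
   one walk count. *)
have -> : \sum_(f : copy) \sum_(g : copy)
      Ex m (fun A => \sum_v around A f v * around A g v) =
    \sum_v Ex m (fun A => walk3_count R A v ^+ (k + k)).
  under eq_bigr do rewrite -Ex_sum.
  rewrite -!Ex_sum; congr (Ex m _); apply/funext => A.
  under eq_bigr do rewrite exchange_big.
  rewrite exchange_big; apply: eq_bigr => v _ /=.
  under eq_bigr do rewrite -mulr_sumr.
  by rewrite -mulr_suml sum_around exprD.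
apply: (@le_trans _ _ (\sum_(v < n) walk_bound (n%:R * q) (k + k) 1)).
  by apply: ler_sum => v _; exact: (walk3_count_moment law).
by rewrite sumr_const card_ord -[leLHS]mulr_natl.
Qed.

(* Chebyshev's inequality, with the bias of copies / n as a separate term. *)
Lemma copies_deviation (l delta : R) : (0 < n)%N -> 0 < delta ->
  \sum_(A | delta <= `|copies A / n%:R - l|) m A <=
  (walk_bound (n%:R * q) (k + k) 1 / n%:R + (Ex m copies / n%:R - l) ^+ 2) /
    delta ^+ 2.
Proof.
move=> n0 d0; have nR : 0 < n%:R :> R by rewrite ltr0n.
rewrite ler_pdivlMr ?exprn_gt0//.
apply: (@le_trans _ _ (Ex m (fun A => (copies A / n%:R - l) ^+ 2))).
  rewrite mulrC mulr_sumr big_mkcond; apply: ler_sum => A _.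
  case: ifPn => [dA|_]; last by rewrite mulr_ge0 ?sqr_ge0// (law_ge0 law).
  rewrite mulrC ler_wpM2l ?(law_ge0 law)//.
  by rewrite -[leRHS]real_normK ?num_real// lerXn2r ?nnegrE// ltW.
have -> : Ex m (fun A => (copies A / n%:R - l) ^+ 2) =
    n%:R^-2 * Ex m (fun A => copies A ^+ 2) + (- 2 * l / n%:R) * Ex m copies + l ^+ 2.
  rewrite -!ExZ -(Ex_cst law (l ^+ 2)) -!ExD; congr (Ex m _).
  by apply/funext => A; field; rewrite gt_eqF.
have := copies_second_moment; set M := Ex m _; set e := Ex m copies.
set w := walk_bound _ _ _ => Mw.
have : n%:R^-2 * M <= n%:R^-2 * (e ^+ 2 + n%:R * w).
  by rewrite ler_wpM2l// invr_ge0 exprn_ge0.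
move=> H1; rewrite -lerBrDr -lerBrDr; apply: le_trans H1 _.
by rewrite le_eqVlt; apply/orP; left; apply/eqP; field; rewrite gt_eqF.
Qed.

End patterns.

(** * Copies as iterated sums, and their expected numbers *)

Section sums_over_tuples.
Context (R : nmodType) (T : finType).

Lemma sum_tuple0 (F : 0.-tuple T -> R) : \sum_t F t = F [tuple].
Proof.
rewrite (bigD1 [tuple])//= big1 ?addr0// => t /eqP tN.
by case: tN; rewrite [t]tuple0; exact: val_inj.
Qed.

Lemma sum_tupleS k (F : k.+1.-tuple T -> R) :
  \sum_t F t = \sum_x \sum_(t : k.-tuple T) F [tuple of x :: t].
Proof.
rewrite pair_big /= (reindex (fun z : T * k.-tuple T => [tuple of z.1 :: z.2])) //=.
exists (fun t => (thead t, [tuple of behead t])) => [[x t] _|t _] /=.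
  by congr pair; exact: val_inj.
by rewrite [RHS]tuple_eta; exact: val_inj.
Qed.

Lemma sum_ffun_tuple k (F : {ffun 'I_k -> T} -> R) :
  \sum_f F f = \sum_(t : k.-tuple T) F [ffun i => tnth t i].
Proof.
rewrite (reindex (fun t : k.-tuple T => [ffun i => tnth t i]))//.
exists (fun f : {ffun 'I_k -> T} => [tuple f i | i < k]) => [t _|f _].
  by apply: eq_from_tnth => i; rewrite tnth_mktuple ffunE.
by apply/ffunP => i; rewrite ffunE tnth_mktuple.
Qed.

Lemma injectiveb_tnth k (t : k.-tuple T) :
  injectiveb [ffun i => tnth t i] = uniq t.
Proof.
apply/injectiveP/tuple_uniqP => H i j ij; apply: H; rewrite ?ffunE//.
by move: ij; rewrite !ffunE.
Qed.

End sums_over_tuples.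

Lemma copies_tuple (R : realType) n k (H : seq ('I_k * 'I_k))
    (A : {set 'I_n * 'I_n}) :
  copies R H A = \sum_(t : k.-tuple 'I_n)
    (uniq t && all (fun e => set_rel A (tnth t e.1) (tnth t e.2)) H)%:R.
Proof.
rewrite /copies big_mkcond sum_ffun_tuple; apply: eq_bigr => t _.
rewrite injectiveb_tnth; case: (uniq t) => //=.
rewrite /all_edges /copy_edges all_map; congr (_%:R); congr nat_of_bool.
by apply: eq_all => e /=; rewrite !ffunE.
Qed.

Section expected_copies.
Context (R : realType) (n : nat).
Variables (m : {set 'I_n * 'I_n} -> R) (q t : R).
Hypothesis law : edge_law m q t.
Context (k : nat).
Implicit Type H : seq ('I_k * 'I_k).

(** The second end of each edge is absent from the rest of the list, so [law_leaf] removes the edges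
    from the head on. *)
Fixpoint leaf_ordered H : bool :=
  if H is e :: H' then
    [&& e.1 != e.2, all (fun h => (h.1 != e.2) && (h.2 != e.2)) H' & leaf_ordered H']
  else true.

Lemma edge_prob_leaf_ordered H (f : {ffun 'I_k -> 'I_n}) : injective f ->
  leaf_ordered H -> edge_prob m (copy_edges H f) = q ^+ size H.
Proof.
move=> f_inj; elim: H => [_|[i j] H IH /= /and3P[ij /allP Hj lH]].
  exact: edge_prob0 law.
rewrite (law_leaf law) ?(inj_eq f_inj)//; first by rewrite IH// exprS.
move=> _ /mapP[h /Hj /andP[h1 h2] ->] /=.
by rewrite !inE !(inj_eq f_inj) h1 h2.
Qed.

Lemma Ex_copies_cst H c :
  (forall f : {ffun 'I_k -> 'I_n}, injective f -> edge_prob m (copy_edges H f) = c) ->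
  Ex m (copies R H) = (n ^_ k)%:R * c.
Proof.
move=> Hc; rewrite /copies Ex_sum.
transitivity (\sum_(f : {ffun 'I_k -> 'I_n} | injectiveb f) c).
  by apply: eq_bigr => f /injectiveP/Hc; rewrite edge_probE.
rewrite sumr_const -[LHS]mulr_natl; congr (_%:R * _).
rewrite -[in RHS](card_ord n) -[in RHS](card_ord k) -card_inj_ffuns.
by apply: eq_card => f; rewrite inE.
Qed.

Lemma Ex_copies_tree H : leaf_ordered H ->
  Ex m (copies R H) = (n ^_ k)%:R * q ^+ size H.
Proof. by move=> lH; apply: Ex_copies_cst => f fi; exact: edge_prob_leaf_ordered. Qed.

End expected_copies.

Notation ord k i := (@Ordinal k i isT).

Definition edge_pattern : seq ('I_2 * 'I_2) := [:: (ord 2 0, ord 2 1)].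
Definition cherry_pattern : seq ('I_3 * 'I_3) :=
  [:: (ord 3 0, ord 3 1); (ord 3 0, ord 3 2)].
Definition claw_pattern : seq ('I_4 * 'I_4) :=
  [:: (ord 4 0, ord 4 1); (ord 4 0, ord 4 2); (ord 4 0, ord 4 3)].
(* The path 2 - 0 - 1 - 3, listed with its leaf edges first. *)
Definition path_pattern : seq ('I_4 * 'I_4) :=
  [:: (ord 4 0, ord 4 2); (ord 4 1, ord 4 3); (ord 4 0, ord 4 1)].
Definition triangle_pattern : seq ('I_3 * 'I_3) :=
  [:: (ord 3 0, ord 3 1); (ord 3 0, ord 3 2); (ord 3 1, ord 3 2)].

Lemma Ex_copies_triangle (R : realType) n (m : {set 'I_n * 'I_n} -> R) q t :
  edge_law m q t -> Ex m (copies R triangle_pattern) = (n ^_ 3)%:R * t.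
Proof.
move=> law; apply: Ex_copies_cst => f fi.
by apply: (law_triangle law); rewrite (inj_eq fi).
Qed.

(** * Degree sums as subgraph counts *)

Section degree_sums.
Context (R : realType) (n : nat) (g : sgraph 'I_n).
Local Notation a u v := ((adj g u v)%:R : R).
Local Notation dg v := ((deg g v)%:R : R).

Lemma deg_sum v : dg v = \sum_u a v u.
Proof.
rewrite /deg -sum1_card natr_sum big_mkcond; apply: eq_bigr => u _.
by rewrite -[u \in adj g v]/(adj g v u); case: (adj g v u).
Qed.

(** Evaluates the innermost sum when the vertices of a copy are required to be distinct. *)
Lemma deg_sum_notin v (s : seq 'I_n) : uniq s ->
  \sum_u (u \notin s)%:R * a v u = dg v - \sum_(u <- s) a v u.
Proof.
move=> us; rewrite deg_sum (big_uniq _ us) [in RHS](bigID (mem s))/= [RHS]addrC addKr.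
rewrite [RHS]big_mkcond; apply: eq_bigr => u _.
by case: (u \in s); rewrite ?mul0r ?mul1r.
Qed.

Definition degree_moment j : R := \sum_v dg v ^+ j.

Definition arc_degree_product : R := \sum_u \sum_v a u v * (dg u * dg v).

Lemma copies_edge : copies R edge_pattern (arcs g) = degree_moment 1.
Proof.
rewrite copies_tuple sum_tupleS; apply: eq_bigr => u _.
rewrite expr1 deg_sum sum_tupleS; apply: eq_bigr => v _.
rewrite sum_tuple0 /= !(tnth_nth u) /= set_rel_arcs !inE !andbT.
by have [->|] := eqVneq u v; rewrite ?adj_irrefl.
Qed.

Let idem u v : a u v * a u v = a u v.
Proof. by rewrite -natrM mulnb andbb. Qed.

Let sym u v : a u v = a v u.
Proof. by rewrite adj_sym. Qed.

(** A centre u has d_u (d_u - 1) ordered pairs of distinct neighbors. *)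
Lemma copies_cherry :
  copies R cherry_pattern (arcs g) = degree_moment 2 - degree_moment 1.
Proof.
rewrite copies_tuple sum_tupleS -sumrB; apply: eq_bigr => u _.
transitivity (\sum_v a u v * (\sum_w (w \notin [:: v])%:R * a u w)).
  rewrite sum_tupleS; apply: eq_bigr => v _; rewrite mulr_sumr sum_tupleS.
  apply: eq_bigr => w _.
  rewrite sum_tuple0 /= !(tnth_nth u) /= !set_rel_arcs !inE !andbT -!natrM !mulnb.
  congr (_%:R); congr nat_of_bool; rewrite (eq_sym w v).
  have [->|_] := eqVneq u v; first by rewrite adj_irrefl.
  have [->|_] := eqVneq u w; first by rewrite adj_irrefl !andbF.
  by rewrite andbCA.
under eq_bigr do rewrite deg_sum_notin// big_seq1 mulrBr idem.
by rewrite sumrB -mulr_suml -deg_sum expr1 expr2.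
Qed.

(** A centre u has d_u (d_u - 1) (d_u - 2) ordered triples of distinct neighbors. *)
Lemma copies_claw : copies R claw_pattern (arcs g) =
  degree_moment 3 - 3 * degree_moment 2 + 2 * degree_moment 1.
Proof.
rewrite copies_tuple sum_tupleS !mulr_sumr -sumrB -big_split; apply: eq_bigr => u _.
transitivity (\sum_v a u v * (\sum_w ((w \notin [:: v])%:R * a u w *
    \sum_x (x \notin [:: v; w])%:R * a u x))).
  rewrite sum_tupleS; apply: eq_bigr => v _; rewrite mulr_sumr sum_tupleS.
  apply: eq_bigr => w _; rewrite !mulr_sumr sum_tupleS; apply: eq_bigr => x _.
  rewrite sum_tuple0 /= !(tnth_nth u) /= !set_rel_arcs !inE !andbT -!natrM !mulnb.
  congr (_%:R); congr nat_of_bool.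
  rewrite (eq_sym w v) (eq_sym x v) (eq_sym x w).
  have [->|_] := eqVneq u v; first by rewrite adj_irrefl.
  have [->|_] := eqVneq u w; first by rewrite adj_irrefl !andbF.
  have [->|_] := eqVneq u x; first by rewrite adj_irrefl !andbF.
  case: (v == w); case: (v == x); case: (w == x);
    by case: (adj g u v); case: (adj g u w); case: (adj g u x).
transitivity (\sum_v a u v * (\sum_w (w \notin [:: v])%:R * a u w) * (dg u - 2)).
  apply: eq_bigr => v _; rewrite -mulrA; rewrite mulr_suml !mulr_sumr.
  apply: eq_bigr => w _; have [->|wv] := eqVneq w v.
    by rewrite inE eqxx !mul0r !mulr0.
  rewrite deg_sum_notin; last by rewrite /= inE eq_sym wv.
  rewrite !big_cons big_nil addr0.
  by case: (adj g u v); case: (adj g u w); rewrite /= ?mul0r ?mulr0//; ring.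
rewrite -mulr_suml.
under eq_bigr do rewrite deg_sum_notin// big_seq1 mulrBr idem.
by rewrite sumrB -mulr_suml -deg_sum; rewrite /=; ring.
Qed.

(** For an arc (u, v) there are (d_u - 1) (d_v - 1) choices of a neighbor x of u other than v and a
    neighbor y of v other than u: a path if x and y differ, a triangle if they coincide. *)
Lemma copies_path_triangle :
  copies R path_pattern (arcs g) + copies R triangle_pattern (arcs g) =
  arc_degree_product - 2 * degree_moment 2 + degree_moment 1.
Proof.
have pathE : copies R path_pattern (arcs g) = \sum_u \sum_v a u v *
    (\sum_x ((x \notin [:: v])%:R * a u x * \sum_y (y \notin [:: u; x])%:R * a v y)).
  rewrite copies_tuple sum_tupleS; apply: eq_bigr => u _.
  rewrite sum_tupleS; apply: eq_bigr => v _; rewrite mulr_sumr sum_tupleS.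
  apply: eq_bigr => x _; rewrite !mulr_sumr sum_tupleS; apply: eq_bigr => y _.
  rewrite sum_tuple0 /= !(tnth_nth u) /= !set_rel_arcs !inE !andbT -!natrM !mulnb.
  congr (_%:R); congr nat_of_bool.
  rewrite (eq_sym x v) (eq_sym y u) (eq_sym y x).
  have [->|_] := eqVneq u v; first by rewrite adj_irrefl !andbF.
  have [->|_] := eqVneq u x; first by rewrite adj_irrefl !andbF.
  have [->|_] := eqVneq v y; first by rewrite adj_irrefl !andbF.
  case: (u == y); case: (v == x); case: (x == y);
    by case: (adj g u v); case: (adj g u x); case: (adj g v _).
have triE : copies R triangle_pattern (arcs g) = \sum_u \sum_v a u v *
    (\sum_x (x \notin [:: v])%:R * a u x * a v x).
  rewrite copies_tuple sum_tupleS; apply: eq_bigr => u _.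
  rewrite sum_tupleS; apply: eq_bigr => v _; rewrite mulr_sumr sum_tupleS.
  apply: eq_bigr => x _.
  rewrite sum_tuple0 /= !(tnth_nth u) /= !set_rel_arcs !inE !andbT -!natrM !mulnb.
  congr (_%:R); congr nat_of_bool; rewrite (eq_sym x v).
  have [->|_] := eqVneq u v; first by rewrite adj_irrefl !andbF.
  have [->|_] := eqVneq u x; first by rewrite adj_irrefl !andbF.
  by case: (v == x); case: (adj g u v); case: (adj g u x).
have -> : copies R path_pattern (arcs g) + copies R triangle_pattern (arcs g) =
    \sum_u \sum_v a u v * ((dg u - 1) * (dg v - 1)).
  rewrite pathE triE -big_split; apply: eq_bigr => u _ /=.
  rewrite -big_split; apply: eq_bigr => v _ /=; rewrite -mulrDr -big_split /=.
  have [uv|] := boolP (adj g u v); last by rewrite !mul0r.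
  congr (_ * _).
  transitivity (\sum_x (x \notin [:: v])%:R * a u x * (dg v - 1)).
    apply: eq_bigr => x _; have [->|xv] := eqVneq x v.
      by rewrite inE eqxx !mul0r addr0.
    have [ux|] := boolP (adj g u x); last by rewrite !mulr0 !mul0r addr0.
    rewrite deg_sum_notin; last first.
      by rewrite /= inE andbT; apply: contraTneq ux => ->; rewrite adj_irrefl.
    rewrite !big_cons big_nil addr0 (sym v u) uv /=.
    by move: (x \notin _)%:R (dg v) (a v x) => b0 b1 b2; ring.
  by rewrite -mulr_suml deg_sum_notin// big_seq1 uv.
have -> : degree_moment 2 = \sum_u \sum_v a u v * dg u.
  by apply: eq_bigr => u _; rewrite -mulr_suml -deg_sum expr2.
(* One of the two second moments is written with the degree at the other end, so that the expansion
   holds term by term. *)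
have E : \sum_u \sum_v a u v * dg u = \sum_u \sum_v a u v * dg v.
  rewrite exchange_big; apply: eq_bigr => u _; apply: eq_bigr => v _.
  by rewrite sym.
rewrite mulr_natl mulr2n [X in _ - (X + _) + _]E.
have -> : degree_moment 1 = \sum_u \sum_v a u v.
  by apply: eq_bigr => u _; rewrite expr1 deg_sum.
rewrite opprD addrA /arc_degree_product -!sumrB -big_split; apply: eq_bigr => u _ /=.
by rewrite -!sumrB -big_split; apply: eq_bigr => v _ /=; ring.
Qed.

Lemma card_arcs : #|arcs g|%:R = degree_moment 1.
Proof.
rewrite -sum1_card natr_sum big_mkcond /=.
rewrite (eq_bigr (fun e => a e.1 e.2)); last first.
  by move=> e _; rewrite inE; case: (adj g _ _).
rewrite -(pair_bigA _ (fun u v => a u v)) /=; apply: eq_bigr => u _.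
by rewrite expr1 deg_sum.
Qed.

Lemma sum_arcs_degrees :
  \sum_(e in arcs g) dg e.1 * dg e.2 = arc_degree_product.
Proof.
rewrite big_mkcond (eq_bigr (fun e => a e.1 e.2 * (dg e.1 * dg e.2))); last first.
  by move=> e _; rewrite inE; case: (adj g _ _); rewrite ?mul1r ?mul0r.
by rewrite -(pair_bigA _ (fun u v => a u v * (dg u * dg v))).
Qed.

End degree_sums.

(** * Limits *)

Section limits.
Context (R : realType).

(** x1, ..., x5 stand for the edge, cherry, claw, path and triangle counts divided by n. In the
    limit the denominator is mu^3 + mu^2 - mu^4 / mu = mu^2, which is positive, so the quotient is
    continuous there. *)
Lemma pearson_limit_continuous (mu tau eps : R) : 0 < mu -> 0 < eps ->
  exists2 delta : R, 0 < delta & forall x1 x2 x3 x4 x5 : R,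
    `|x1 - mu| < delta -> `|x2 - mu ^+ 2| < delta ->
    `|x3 - mu ^+ 3| < delta -> `|x4 - mu ^+ 3| < delta ->
    `|x5 - tau| < delta ->
    [/\ x1 != 0, x3 + x2 - x2 ^+ 2 / x1 != 0 &
      `|(x4 + x5 - x2 ^+ 2 / x1) / (x3 + x2 - x2 ^+ 2 / x1) - tau / mu ^+ 2|
        < eps].
Proof.
move=> mu0 eps0.
(* A point of R^5 as nested pairs, whose balls are products: one delta bounds all five
   deviations. *)
pose z0 := ((((mu, mu ^+ 2), mu ^+ 3), mu ^+ 3), tau).
have c5 : z.2 @[z --> z0] --> tau by exact: cvg_snd.
have c4 : z.1.2 @[z --> z0] --> mu ^+ 3.
  exact: (cvg_comp fst snd cvg_fst cvg_snd).
have c3 : z.1.1.2 @[z --> z0] --> mu ^+ 3.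
  exact: (cvg_comp fst _ cvg_fst (cvg_comp fst snd cvg_fst cvg_snd)).
have c2 : z.1.1.1.2 @[z --> z0] --> mu ^+ 2.
  exact: (cvg_comp fst _ cvg_fst (cvg_comp fst _ cvg_fst
    (cvg_comp fst snd cvg_fst cvg_snd))).
have c1 : z.1.1.1.1 @[z --> z0] --> mu.
  exact: (cvg_comp fst _ cvg_fst (cvg_comp fst _ cvg_fst
    (cvg_comp fst fst cvg_fst cvg_fst))).
have muN0 : mu != 0 by rewrite gt_eqF.
have cq : z.1.1.1.2 ^+ 2 / z.1.1.1.1 @[z --> z0] --> (mu ^+ 2) ^+ 2 / mu.
  apply: cvgM; last exact: cvgV.
  by rewrite expr2; under eq_fun do rewrite expr2; exact: cvgM.
have cd : z.1.1.2 + z.1.1.1.2 - z.1.1.1.2 ^+ 2 / z.1.1.1.1 @[z --> z0] -->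
    mu ^+ 3 + mu ^+ 2 - (mu ^+ 2) ^+ 2 / mu.
  by apply: cvgB => //; exact: cvgD.
have cn : z.1.2 + z.2 - z.1.1.1.2 ^+ 2 / z.1.1.1.1 @[z --> z0] -->
    mu ^+ 3 + tau - (mu ^+ 2) ^+ 2 / mu.
  by apply: cvgB => //; exact: cvgD.
have dE : mu ^+ 3 + mu ^+ 2 - (mu ^+ 2) ^+ 2 / mu = mu ^+ 2 by field.
have nE : mu ^+ 3 + tau - (mu ^+ 2) ^+ 2 / mu = tau by field.
rewrite dE in cd; rewrite nE in cn.
have d0 : mu ^+ 2 != 0 by rewrite expf_neq0.
have cr : (z.1.2 + z.2 - z.1.1.1.2 ^+ 2 / z.1.1.1.1) /
    (z.1.1.2 + z.1.1.1.2 - z.1.1.1.2 ^+ 2 / z.1.1.1.1) @[z --> z0] -->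
    tau / mu ^+ 2.
  by apply: cvgM => //; exact: cvgV.
have n1 : \forall z \near z0, z.1.1.1.1 != 0.
  by apply: (cvgr_neq0 _ c1).
have n2 : \forall z \near z0,
    z.1.1.2 + z.1.1.1.2 - z.1.1.1.2 ^+ 2 / z.1.1.1.1 != 0.
  by apply: (cvgr_neq0 _ cd).
have n3 : \forall z \near z0, `|tau / mu ^+ 2 -
    (z.1.2 + z.2 - z.1.1.1.2 ^+ 2 / z.1.1.1.1) /
    (z.1.1.2 + z.1.1.1.2 - z.1.1.1.2 ^+ 2 / z.1.1.1.1)| < eps.
  exact: (@cvgr_dist_lt _ _ _ _ _ _ _ cr).
have [delta /= delta0 H] := (nbhs_ballP z0 _).1 (filterI n1 (filterI n2 n3)).
exists delta => //.
move=> x1 x2 x3 x4 x5 h1 h2 h3 h4 h5.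
have : ball z0 delta ((((x1, x2), x3), x4), x5).
  by do !split; rewrite /ball /= distrC.
by move=> /H[/= ? [? ?]]; split => //; rewrite distrC.
Qed.

Lemma cvg_invn : (n%:R : R)^-1 @[n --> \oo] --> (0 : R).
Proof. by rewrite -cvg_shiftS; exact: cvg_harmonic. Qed.

Lemma ffact_expn_cvg k : (n ^_ k)%:R / n%:R ^+ k @[n --> \oo] --> (1 : R).
Proof.
elim: k => [|k IH].
  by under eq_fun do rewrite expr0 ffactn0 divr1; exact: cvg_cst.
have kn : 1 - k%:R / n%:R @[n --> \oo] --> (1 - k%:R * 0 : R).
  by apply: cvgB; [|apply: cvgM; [|exact: cvg_invn]]; exact: cvg_cst.
rewrite mulr0 subr0 in kn.
have IHkn : (n ^_ k)%:R / n%:R ^+ k * (1 - k%:R / n%:R) @[n --> \oo] -->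
    (1 * 1 : R) by apply: cvgM.
rewrite mulr1 in IHkn; apply: cvg_trans IHkn; apply: near_eq_cvg.
near=> n; have n0 : (0 < n)%N by near: n; exact: nbhs_infty_gt.
have nk : (k <= n)%N by near: n; exact: nbhs_infty_ge.
rewrite /= ffactnSr natrM natrB// exprSr.
by field; rewrite expf_neq0 pnatr_eq0 -lt0n n0.
Unshelve. all: by end_near. Qed.

(** A pattern on k + 1 vertices with probability l / n^k has about l n copies. As q = c / n, the
    walk bound is a constant K, and the variance of the count divided by n is at most K / n. *)
Lemma copies_in_probability (m : forall n, {set 'I_n * 'I_n} -> R)
    (t : nat -> R) (c l : R) (k : nat) (H : seq ('I_k.+1 * 'I_k.+1))
    (hub : 'I_k.+1 -> 'I_k.+1) (delta : R) :
  0 <= c ->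
  (\forall n \near \oo, edge_law (m n) (c / n%:R) (t n)) ->
  (forall a, lazy_pattern H a (hub a)) ->
  (forall a b, lazy_pattern H (hub a) (hub b)) ->
  (\forall n \near \oo, Ex (m n) (copies R H) =
    (n ^_ k.+1)%:R * (l / n%:R ^+ k)) ->
  0 < delta ->
  \sum_(A | delta <= `|copies R H A / n%:R - l|) m n A @[n --> \oo] --> (0 : R).
Proof.
move=> c0 law h1 h2 ExE d0.
pose K := walk_bound c (k.+1 + k.+1) 1.
pose e n : R := (n ^_ k.+1)%:R / n%:R ^+ k.+1 * l.
have el : e n @[n --> \oo] --> l.
  rewrite -[l in X in _ --> X]mul1r; apply: cvgM; last exact: cvg_cst.
  exact: ffact_expn_cvg.
have bl : (K / n%:R + (e n - l) ^+ 2) / delta ^+ 2 @[n --> \oo] -->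
    (K * 0 + (l - l) * (l - l)) / delta ^+ 2.
  apply: cvgM; last exact: cvg_cst.
  apply: cvgD.
    by apply: cvgM; [exact: cvg_cst|exact: cvg_invn].
  under eq_fun do rewrite expr2.
  by apply: cvgM; apply: cvgB => //; exact: cvg_cst.
rewrite subrr !mulr0 addr0 mul0r in bl.
apply: (squeeze_cvgr _ (@cvg_cst _ (0 : R) _ _ _) bl).
near=> n.
have n0 : (0 < n)%N by near: n; exact: nbhs_infty_gt.
have lawn : edge_law (m n) (c / n%:R) (t n) by near: n.
have En : Ex (m n) (copies R H) = (n ^_ k.+1)%:R * (l / n%:R ^+ k) by near: n.
have cn : 0 <= c / n%:R by rewrite divr_ge0.
apply/andP; split.
  by apply: sumr_ge0 => A _; exact: law_ge0 lawn _.
have := copies_deviation lawn cn h1 h2 l n0 d0.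
rewrite En [n%:R * (c / _)]mulrC mulfVK ?pnatr_eq0 -?lt0n// -/K.
rewrite (_ : (n ^_ k.+1)%:R * (l / n%:R ^+ k) / n%:R = e n)//.
by rewrite /e exprSr invfM; ring.
Unshelve. all: by end_near. Qed.

(** Turns events about the graph into events about its arc set, to which [mass] applies. *)
Lemma arcs_inj n : injective (@arcs 'I_n).
Proof.
move=> [r rs ri] [r' rs' ri'] rr'.
have E : r = r'.
  apply/funext => u; apply/funext => v.
  by have /setP/(_ (u, v)) := rr'; rewrite !inE.
subst r'; congr SGraph; exact: Prop_irrelevance.
Qed.

(** The correction is n (x2 + x1)^2 / x1 = n (x2^2 / x1 + 2 x2 + x1). Its last two terms cancel
    against the numerator and the denominator, and the common factor n drops out. *)
Lemma pearson_copies (c : R) n (g : sgraph 'I_n) (x : forall k, seq ('I_k * 'I_k) -> R) :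
  (0 < n)%N ->
  (forall k (H : seq ('I_k * 'I_k)), x k H = copies R H (arcs g) / n%:R) ->
  let x1 := x _ edge_pattern in let x2 := x _ cherry_pattern in
  let x3 := x _ claw_pattern in let x4 := x _ path_pattern in
  let x5 := x _ triangle_pattern in
  x1 != 0 -> x3 + x2 - x2 ^+ 2 / x1 != 0 ->
  pearson c g = (x4 + x5 - x2 ^+ 2 / x1) / (x3 + x2 - x2 ^+ 2 / x1).
Proof.
move=> n0 xE x1 x2 x3 x4 x5 x10 den0.
have nR : n%:R != 0 :> R by rewrite pnatr_eq0 -lt0n.
have xn k (H : seq ('I_k * 'I_k)) : copies R H (arcs g) = n%:R * x k H.
  by rewrite xE mulrC divfK.
have M1 : degree_moment R g 1 = n%:R * x1 by rewrite -copies_edge xn.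
have M2 : degree_moment R g 2 = n%:R * (x2 + x1).
  have := copies_cherry R g; rewrite xn M1 => /eqP; rewrite eq_sym subr_eq => /eqP ->.
  by rewrite mulrDr.
have M3 : degree_moment R g 3 = n%:R * (x3 + 3 * x2 + x1).
  have := copies_claw R g; rewrite xn M1 M2 -/x3 => E; rewrite [RHS]mulrDr mulrDr E; ring.
have AP : arc_degree_product R g = n%:R * (x4 + x5 + 2 * x2 + x1).
  have := copies_path_triangle R g; rewrite !xn M1 M2 -/x4 -/x5 => E.
  by rewrite !mulrDr E; ring.
have corr : #|arcs g|%:R^-1 * (\sum_(v : 'I_n) (deg g v)%:R ^+ 2) ^+ 2 =
    n%:R * (x2 + x1) ^+ 2 / x1 :> R.
  rewrite (card_arcs R g) -[\sum_v _]/(degree_moment R g 2) M1 M2.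
  by field; rewrite nR x10.
rewrite /pearson corr sum_arcs_degrees -[\sum_v _]/(degree_moment R g 3) M3 AP.
have -> : n%:R * (x3 + 3 * x2 + x1) - n%:R * (x2 + x1) ^+ 2 / x1 =
    n%:R * (x3 + x2 - x2 ^+ 2 / x1) by field.
have -> : n%:R * (x4 + x5 + 2 * x2 + x1) - n%:R * (x2 + x1) ^+ 2 / x1 =
    n%:R * (x4 + x5 - x2 ^+ 2 / x1) by field.
rewrite mulf_eq0 (negbTE nR) (negbTE den0) orbF ifF; last first.
  apply/negbTE; move: x10; apply: contra => /orP[/eqP A0|//].
  have := card_arcs R g; rewrite A0 M1 => /esym/eqP.
  by rewrite mulf_eq0 (negbTE nR).
by rewrite invfM mulrACA divff// mul1r.
Qed.

End limits.

(** * Hubs of the five patterns *)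

Lemma edge_hubP a : lazy_pattern edge_pattern a (ord 2 0).
Proof. by case: a => [[|[|[]]]]. Qed.

Lemma cherry_hubP a : lazy_pattern cherry_pattern a (ord 3 0).
Proof. by case: a => [[|[|[|[]]]]]. Qed.

Lemma claw_hubP a : lazy_pattern claw_pattern a (ord 4 0).
Proof. by case: a => [[|[|[|[|[]]]]]]. Qed.

Lemma triangle_hubP a : lazy_pattern triangle_pattern a (ord 3 0).
Proof. by case: a => [[|[|[|[]]]]]. Qed.

(** On the path 2 - 0 - 1 - 3, even labels belong to the inner vertex 0 and odd ones to the inner
    vertex 1. *)
Definition path_hub (a : 'I_4) : 'I_4 := if odd a then ord 4 1 else ord 4 0.

Lemma path_hubP a : lazy_pattern path_pattern a (path_hub a).
Proof. by case: a => [[|[|[|[|[]]]]]]. Qed.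

Lemma path_hub_hub a b : lazy_pattern path_pattern (path_hub a) (path_hub b).
Proof. by rewrite /path_hub; case: (odd a); case: (odd b). Qed.

Lemma side_gt (R : realType) (d : nat) (r : R) : (0 < d)%N -> 0 <= r ->
  \forall n \near \oo, r < side R d n.
Proof.
move=> d0 r0; near=> n; rewrite /side.
have dR : d%:R != 0 :> R by rewrite pnatr_eq0 -lt0n.
have -> : r = (r `^ d%:R) `^ d%:R^-1 by rewrite -powRrM mulfV// powRr1.
apply: gt0_ltr_powR; rewrite ?nnegrE ?powR_ge0 ?invr_gt0 ?ltr0n//.
by near: n; exact: nbhs_infty_gtr.
Unshelve. all: by end_near. Qed.

Lemma sum_mass_or (R : realType) (I : finType) (m : I -> R) (Q Q1 Q2 : pred I) :
  (forall A, 0 <= m A) -> (forall A, Q A -> Q1 A || Q2 A) ->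
  \sum_(A | Q A) m A <= \sum_(A | Q1 A) m A + \sum_(A | Q2 A) m A.
Proof.
move=> m0 H; rewrite !(big_mkcond _ m) -big_split; apply: ler_sum => A _ /=.
case: ifP => [/H|_]; last by rewrite addr_ge0//; case: ifP.
by case: (Q1 A); case: (Q2 A) => //= _; rewrite ?addr0 ?add0r// lerDl.
Qed.

Theorem proposition3p4 (R : realType) (d : nat) (rad p c : R)
    (disp : nat -> measure_display)
    (T : forall n : nat, measurableType (disp n))
    (P : forall n : nat, probability (T n) R)
    (X : forall n : nat, 'I_n -> {RV (P n) >-> d.-tuple R})
    (G : forall n : nat, T n -> sgraph 'I_n) :
  (1 <= d)%N -> 0 < rad -> 0 < p -> p <= 1 ->
  (forall n : nat, (1 <= n)%N -> is_RGG p rad (X n) (G n)) ->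
  cvg_in_probability P (fun n w => pearson c (G n w)) (p * p_conn d rad).
Proof.
move=> d1 rad0 p0 p1 rgg eps eps0.
pose mu := p * omega d rad; pose tau := p ^+ 3 * (omega d rad ^+ 2 * p_conn d rad).
have w0 := omega_gt0 d rad0.
have mu0 : 0 < mu by rewrite mulr_gt0.
have -> : p * p_conn d rad = tau / mu ^+ 2.
  by rewrite /tau /mu; field; rewrite !gt_eqF.
pose m n := mass (P n) (G n).
have law : \forall n \near \oo, edge_law (m n) (mu / n%:R) (tau / n%:R ^+ 2).
  near=> n; have n0 : (0 < n)%N by near: n; exact: nbhs_infty_gt.
  apply: (rgg_edge_law (rgg n n0)) => //.
  by near: n; apply: side_gt => //; rewrite mulr_ge0// ltW.
have [delta delta0 cont] := pearson_limit_continuous tau mu0 eps0.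
pose dev k (H : seq ('I_k * 'I_k)) (l : R) n (A : {set 'I_n * 'I_n}) :=
  delta <= `|copies R H A / n%:R - l|.
have tree k (H : seq ('I_k.+1 * 'I_k.+1)) hub : leaf_ordered H -> size H = k ->
    (forall a, lazy_pattern H a (hub a)) ->
    (forall a b, lazy_pattern H (hub a) (hub b)) ->
    \sum_(A | dev _ H (mu ^+ k) n A) m n A @[n --> \oo] --> (0 : R).
  move=> lH sH h1 h2; apply: (copies_in_probability (ltW mu0) law h1 h2) => //.
  near=> n; have lawn : edge_law (m n) (mu / n%:R) (tau / n%:R ^+ 2) by near: n.
  by rewrite (Ex_copies_tree lawn lH) sH expr_div_n.
have l1 := tree _ edge_pattern _ isT erefl edge_hubP (fun _ _ => isT).
have l2 := tree _ cherry_pattern _ isT erefl cherry_hubP (fun _ _ => isT).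
have l3 := tree _ claw_pattern _ isT erefl claw_hubP (fun _ _ => isT).
have l4 := tree _ path_pattern _ isT erefl path_hubP path_hub_hub.
have l5 : \sum_(A | dev _ triangle_pattern tau n A) m n A @[n --> \oo] --> (0 : R).
  apply: (copies_in_probability (ltW mu0) law triangle_hubP (fun _ _ => isT)) => //.
  near=> n; have lawn : edge_law (m n) (mu / n%:R) (tau / n%:R ^+ 2) by near: n.
  exact: Ex_copies_triangle lawn.
pose bound n : R :=
  \sum_(A | dev _ edge_pattern (mu ^+ 1) n A) m n A +
  (\sum_(A | dev _ cherry_pattern (mu ^+ 2) n A) m n A +
  (\sum_(A | dev _ claw_pattern (mu ^+ 3) n A) m n A +
  (\sum_(A | dev _ path_pattern (mu ^+ 3) n A) m n A +
   \sum_(A | dev _ triangle_pattern tau n A) m n A))).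
have bound0 : bound n @[n --> \oo] --> (0 + (0 + (0 + (0 + 0))) : R).
  by do 4 (apply: cvgD => //).
rewrite !addr0 in bound0.
apply: (@squeeze_cvge _ _ _ _ (cst 0%E) _ (fun n => (bound n)%:E)).
- near=> n; apply/andP; split; first exact: measure_ge0.
  have n0 : (0 < n)%N by near: n; exact: nbhs_infty_gt.
  (* [pearson] takes a graph, so the event is transported to arc sets through some graph with these
     arcs, unique by [arcs_inj]. *)
  pose Q (A : {set 'I_n * 'I_n}) := `[< exists2 g : sgraph 'I_n, arcs g = A &
    eps < `|pearson c g - tau / mu ^+ 2| >].
  rewrite (_ : [set w | _] = [set w | Q (arcs (G n w))]); last first.
    apply/seteqP; split=> w /= H; first by apply/asboolP; exists (G n w).
    by move/asboolP : H => [g /arcs_inj ->].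
  rewrite (probability_arcs (rgg n n0)) lee_fin.
  have m0 A : 0 <= m n A := mass_ge0 _ _ _.
  pose D1 := dev _ edge_pattern (mu ^+ 1) n.
  pose D2 := dev _ cherry_pattern (mu ^+ 2) n.
  pose D3 := dev _ claw_pattern (mu ^+ 3) n.
  pose D4 := dev _ path_pattern (mu ^+ 3) n.
  pose D5 := dev _ triangle_pattern tau n.
  (* By contraposition: if all five counts are within delta of their limits, the quotient is defined
     and within eps of its limit. *)
  have QD A : Q A -> [|| D1 A, D2 A, D3 A, D4 A | D5 A].
    move=> /asboolP[g <- gfar]; apply: contraLR gfar.
    rewrite /D1 /D2 /D3 /D4 /D5 /dev expr1 !negb_or -!ltNge.
    move=> /and5P[h1 h2 h3 h4 h5].
    have [x1N0 denN0 near_l] := cont _ _ _ _ _ h1 h2 h3 h4 h5.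
    pose x k (H : seq ('I_k * 'I_k)) : R := copies R H (arcs g) / n%:R.
    by rewrite (@pearson_copies _ c n g x)// -leNgt ltW.
  apply: le_trans (sum_mass_or m0 QD) _; rewrite lerD2l.
  apply: le_trans (sum_mass_or m0 (fun _ => id)) _; rewrite lerD2l.
  apply: le_trans (sum_mass_or m0 (fun _ => id)) _; rewrite lerD2l.
  exact: (sum_mass_or m0 (fun _ => id)).
- exact: cvg_cst.
- apply: cvg_EFin; last exact: bound0.
  by near=> n.
Unshelve. all: by end_near. Qed.
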